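(* Fix $1<p<\infty$, let $1<q<\infty$ satisfy $\frac1p+\frac1q=1$, and fix an integer $r>1$. Then every infinite dimensional subspace $X\subseteq \ell_p$ has an infinite dimensional subspace $Y\subseteq X$ such that for every $x\in Y$ $$4^{-6}\|x\|_p\le (\log_2 r)^{1/p}\,|x|_{p,r}\le 3\cdot 4^{7}(p+q)\,\|x\|_p .$$
   Context: $\|\cdot\|_p$ is the usual norm on $\ell_p$, $(e_n)$ is the unit vector basis, $c_{00}$ is the space of finitely supported real sequences, and $\langle x,y\rangle=\sum_i x(i)y(i)$. Let $K^{\mathcal M}_{q,r}$ be the smallest subset of $c_{00}$ that contains all vectors $\pm e_n$ ($n\in\mathbb N$) and has the property: whenever $y_1,\dots,y_l\in K^{\mathcal M}_{q,r}$ with $l\le r$ and the supports of $y_i$ are pairwise disjoint, then $r^{-1/q}(y_1+\dots+y_l)\in K^{\mathcal M}_{q,r}$. (One has $K^{\mathcal M}_{q,r}\subseteq B_{\ell_q}$.) The modified Tsirelson-type norm is $|x|_{p,r}=\sup\{\langle x,y\rangle : y\in K^{\mathcal M}_{q,r}\}$ for $x\in\ell_p$; equivalently, on $c_{00}$ it is the unique norm satisfying $|x|_{p,r}=\max\{\|x\|_\infty, r^{-1/q}\sup\sum_{i=1}^r|F_ix|_{p,r}\}$, the supremum over pairwise disjoint $F_1,\dots,F_r\subseteq\mathbb N$, where $Fx$ denotes the restriction of $x$ to $F$. *)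

(* Defs.v *)
From HB Require Import structures.
From mathcomp Require Import all_boot all_order all_algebra.
From mathcomp Require Import all_classical all_reals all_analysis.
Set Implicit Arguments. Unset Strict Implicit. Unset Printing Implicit Defensive.
Import Order.TTheory GRing.Theory Num.Theory.
Import numFieldNormedType.Exports.
Local Open Scope classical_set_scope.
Local Open Scope ring_scope.

Section Defs.
Variable R : realType.

Definition psum (p : R) (x : nat -> R) : \bar R :=
  (\sum_(i <oo) ((`|x i| `^ p)%:E))%E.

Definition in_lp (p : R) (x : nat -> R) : Prop := (psum p x < +oo)%E.

Definition lpnorm (p : R) (x : nat -> R) : R := (fine (psum p x)) `^ (p^-1).

(* <x, y> = sum_i x(i) y(i)  (used with y finitely supported) *)
Definition inner (x y : nat -> R) : R := limn [series x i * y i]_i.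

Inductive KM (q : R) (r : nat) : (nat -> R) -> Prop :=
| KM_unit (n : nat) (s : R) : (s = 1 \/ s = -1) ->
    KM q r (fun i => if i == n then s else 0)
| KM_comb (ys : seq (nat -> R)) :
    (0 < size ys <= r)%N ->
    (forall y, y \in ys -> KM q r y) ->
    (forall (a b : nat), (a < size ys)%N -> (b < size ys)%N -> a <> b ->
        forall i, nth (fun _ => 0) ys a i <> 0 -> nth (fun _ => 0) ys b i = 0) ->
    KM q r (fun i => (r%:R `^ (- q^-1)) * \sum_(y <- ys) y i).

(* |x|_{p,r} = sup { <x,y> : y in K^M_{q,r} }, q the conjugate exponent of p *)
Definition tnorm (p q : R) (r : nat) (x : nat -> R) : R :=
  sup [set t | exists y, KM q r y /\ t = inner x y].

Definition closed_subspace_lp (p : R) (X : set (nat -> R)) : Prop :=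
  [/\ (forall x, X x -> in_lp p x),
      X (fun _ => 0),
      (forall x y, X x -> X y -> X (fun i => x i + y i)),
      (forall (c : R) x, X x -> X (fun i => c * x i)) &
      (forall (u : nat -> nat -> R) (x : nat -> R),
          (forall n, X (u n)) -> in_lp p x ->
          (fun n => lpnorm p (fun i => u n i - x i)) @ \oo --> (0 : R) -> X x)].

Definition inf_dim (X : set (nat -> R)) : Prop :=
  forall n : nat, exists v : 'I_n -> nat -> R,
    (forall k, X (v k)) /\
    (forall c : 'I_n -> R,
        (forall i, \sum_(k < n) c k * v k i = 0) -> forall k, c k = 0).

End Defs.

(* Main.v *)
(* Write k for the integer part of log_2 r and rho = r ^ (1/k), so 2 <= rho <= 4.  Elements of
   the norming set have entries whose q-th powers lie in {0} U {r ^ -m} and sum to at most 1,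
   and Kraft's inequality gives the converse.  Hence pairing a vector with the norming set
   only sees the scales |x(c)|^p modulo r, that is, k residue classes of levels in base rho.

   If every class carries comparable p-mass then |x|_{p,r} is of order k^(-1/p) |x|_p: the
   lower bound uses a single class, on which r-adic weights match |x|^p up to a constant; for
   the upper bound, a coordinate in the class s pairs with a weight either at most
   rho^(-s/q) times the extremal one, which sums geometrically over s, or is larger than a
   fixed multiple of |x(c)|^p, and those weights are controlled by Kraft's sum.

   An arbitrary X contains small perturbations of disjoint blocks u.  By the pigeonhole
   principle infinitely many of them share approximately the same mass vector, and averaging
   rho^j of them with coefficient rho^(-j/p), for j = 0..k-1, shifts this vector cyclically and
   makes it uniform.  Combinations of such superblocks stay uniform, since a scalar only
   shifts classes.  Y is the closed span of the corresponding elements of X. *)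
Require Import Defs.
From HB Require Import structures.
From mathcomp Require Import all_boot all_order all_algebra.
From mathcomp Require Import all_classical all_reals all_analysis.
From mathcomp Require Import ring lra zify.
Set Implicit Arguments. Unset Strict Implicit. Unset Printing Implicit Defensive.
Import Order.TTheory GRing.Theory Num.Theory.
Import numFieldNormedType.Exports.
Local Open Scope classical_set_scope.
Local Open Scope ring_scope.

(** * Sequence spaces *)

Section LpNorm.
Context {R : realType}.
Implicit Types (p q c : R) (x y : nat -> R).

Lemma le_powR (a b c : R) : 0 <= c -> 0 <= a -> a <= b -> a `^ c <= b `^ c.
Proof.
by move=> c0 a0 ab; apply: ge0_ler_powR; rewrite ?nnegrE// (le_trans a0 ab).
Qed.

Lemma psum_ge0 p x : (0 <= psum p x)%E.
Proof. by apply: nneseries_ge0 => n _ _; rewrite lee_fin powR_ge0. Qed.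

Lemma lpnorm_ge0 p x : 0 <= lpnorm p x.
Proof. exact: powR_ge0. Qed.

Lemma psum_finE p x : in_lp p x -> psum p x = (fine (psum p x))%:E.
Proof. by move=> xp; rewrite fineK// ge0_fin_numE// psum_ge0. Qed.

Lemma lpnorm_powR p x : 0 < p -> lpnorm p x `^ p = fine (psum p x).
Proof.
move=> p0; rewrite /lpnorm -powRrM mulVf ?gt_eqF// powRr1//.
by rewrite fine_ge0// psum_ge0.
Qed.

(** Passing to the L^p norm of the counting measure gives access to Minkowski's and Hölder's
    inequalities. *)
Lemma Lnorm_psum p x : 0 < p ->
  Lnorm counting p%:E (EFin \o x) = (psum p x `^ p^-1)%E.
Proof. by move=> p0; rewrite Lnorm_counting. Qed.

Lemma Lnorm_lpnorm p x : 0 < p -> in_lp p x ->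
  Lnorm counting p%:E (EFin \o x) = (lpnorm p x)%:E.
Proof. by move=> p0 xp; rewrite Lnorm_psum// psum_finE. Qed.

Lemma Lnorm_lty p x : 0 < p ->
  in_lp p x <-> (Lnorm counting p%:E (EFin \o x) < +oo)%E.
Proof.
move=> p0; rewrite Lnorm_psum//; split; first exact: poweR_lty.
rewrite /in_lp; case: (psum p x) (psum_ge0 p x) => [s||]// _; first by move=> _; exact: ltry.
by rewrite poweRyr// invr_eq0 gt_eqF.
Qed.

Lemma lpnormD p x y : 1 <= p -> in_lp p x -> in_lp p y ->
  in_lp p (fun i => x i + y i) /\
  lpnorm p (fun i => x i + y i) <= lpnorm p x + lpnorm p y.
Proof.
move=> p1 xp yp; have p0 : 0 < p := lt_le_trans ltr01 p1.
have : (Lnorm counting p%:E (EFin \o (fun i => (x i + y i)%R)) <=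
    Lnorm counting p%:E (EFin \o x) + Lnorm counting p%:E (EFin \o y))%E.
  exact: (@minkowski_EFin _ _ _ counting).
rewrite (Lnorm_lpnorm _ xp)// (Lnorm_lpnorm _ yp)// => mink.
have xyp : in_lp p (fun i => x i + y i) by apply/Lnorm_lty => //; exact: (le_lt_trans mink (ltry _)).
by split => //; move: mink; rewrite Lnorm_lpnorm// -EFinD lee_fin.
Qed.

Lemma psumZ p c x : psum p (fun i => c * x i) = ((`|c| `^ p)%:E * psum p x)%E.
Proof.
rewrite /psum -nneseriesZl; last by move=> i _; rewrite lee_fin powR_ge0.
by apply: eq_eseriesr => i _; rewrite normrM powRM// EFinM.
Qed.

Lemma lpnormZ p c x : 0 < p -> in_lp p x ->
  in_lp p (fun i => c * x i) /\ lpnorm p (fun i => c * x i) = `|c| * lpnorm p x.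
Proof.
move=> p0 xp; split; first by rewrite /in_lp psumZ psum_finE// -EFinM ltry.
rewrite /lpnorm psumZ psum_finE//= powRM ?powR_ge0 ?fine_ge0 ?psum_ge0//.
by rewrite -powRrM divff ?gt_eqF// powRr1.
Qed.

Lemma psum_fin_supp p x N : 0 < p -> (forall i, (N <= i)%N -> x i = 0) ->
  psum p x = (\sum_(0 <= i < N) `|x i| `^ p)%:E.
Proof.
move=> p0 xN; rewrite /psum (nneseries_split 0 N); last first.
  by move=> i _; rewrite lee_fin powR_ge0.
rewrite add0n sumEFin eseries0 ?adde0// => i Ni _.
by rewrite xN// normr0 powR0// gt_eqF.
Qed.

Lemma in_lp_fin_supp p x N : 0 < p -> (forall i, (N <= i)%N -> x i = 0) -> in_lp p x.
Proof. by move=> p0 xN; rewrite /in_lp (psum_fin_supp p0 xN) ltry. Qed.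

Lemma lpnorm_fin_supp p x N : 0 < p -> (forall i, (N <= i)%N -> x i = 0) ->
  lpnorm p x = (\sum_(0 <= i < N) `|x i| `^ p) `^ p^-1.
Proof. by move=> p0 xN; rewrite /lpnorm (psum_fin_supp p0 xN). Qed.

Lemma hoelder_fin_supp p q x y N : 0 < p -> 0 < q -> p^-1 + q^-1 = 1 ->
  in_lp p x -> (forall i, (N <= i)%N -> y i = 0) ->
  \sum_(0 <= i < N) `|x i * y i| <= lpnorm p x * lpnorm q y.
Proof.
move=> p0 q0 pq xp yN.
have := @hoelder _ _ R counting x y p q _ _ p0 q0 pq => /(_ (fun _ _ _ => I) (fun _ _ _ => I)).
rewrite (Lnorm_lpnorm _ xp)// (Lnorm_lpnorm _ (in_lp_fin_supp q0 yN))//.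
have xyN i : (N <= i)%N -> (fun i => x i * y i) i = 0 by move=> /yN /= ->; rewrite mulr0.
rewrite (@Lnorm_lpnorm 1 (fun i => x i * y i))//; last exact: in_lp_fin_supp xyN.
rewrite (lpnorm_fin_supp ltr01 xyN) invr1 powRr1; last first.
  by rewrite sumr_ge0// => i _; rewrite powR_ge0.
by under eq_bigr do rewrite powRr1//; rewrite -EFinM lee_fin.
Qed.

Lemma lpnorm_tail p x (e : R) : 0 < p -> in_lp p x -> 0 < e ->
  exists N0, forall N, (N0 <= N)%N ->
    in_lp p (fun i => if (N <= i)%N then x i else 0) /\
    lpnorm p (fun i => if (N <= i)%N then x i else 0) <= e.
Proof.
move=> p0 xp e0; have xi i : (0 <= (`|x i| `^ p)%:E)%E by rewrite lee_fin powR_ge0.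
have tl := nneseries_tail_cvg xp (fun i _ => xi i).
have : \forall N \near \oo, (\sum_(N <= i <oo) (`|x i| `^ p)%:E < (e `^ p)%:E)%E.
  apply: (tl [set z | (z < (e `^ p)%:E)%E]).
  have : \forall z \near (0 : R), z < e `^ p by apply: lt_nbhsl; rewrite powR_gt0.
  by apply: filterS => z /=; rewrite lte_fin.
case=> N0 _ hN0; exists N0 => N /hN0 /= hN.
have psE : psum p (fun i => if (N <= i)%N then x i else 0) =
    (\sum_(N <= i <oo) (`|x i| `^ p)%:E)%E.
  rewrite /psum (nneseries_split 0 N); last by move=> i _; rewrite lee_fin powR_ge0.
  rewrite add0n big_nat_cond big1 ?add0e; last first.
    move=> i /andP[/andP[_ iN] _]; rewrite leqNgt iN /=.
    by rewrite normr0 powR0// gt_eqF.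
  by apply/congr_lim/funext => n; apply: eq_big_nat => i /andP[-> _].
have tp : in_lp p (fun i => if (N <= i)%N then x i else 0).
  by rewrite /in_lp psE (lt_trans hN)// ltry.
split=> //; rewrite leNgt; apply/negP => /(gt0_ltr_powR p0).
rewrite !nnegrE ltW// lpnorm_ge0 => /(_ isT isT).
by rewrite lpnorm_powR// -lte_fin -psum_finE// psE ltNge (ltW hN).
Qed.
End LpNorm.

(** * The norming set *)

Section Norming.
Context {R : realType}.
Implicit Types (p q c : R) (r N : nat) (x y z : nat -> R).

Lemma inner_fin_supp x y N : (forall i, (N <= i)%N -> y i = 0) ->
  inner x y = \sum_(0 <= i < N) x i * y i.
Proof.
move=> yN; apply: lim_near_cst => //; exists N => // n /= Nn.
rewrite /series/= (big_cat_nat (n := N))//= [X in _ + X]big_nat_cond [X in _ + X]big1 ?addr0//.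
by move=> i /andP[/andP[Ni _] _]; rewrite yN// mulr0.
Qed.

(** At a fixed coordinate at most one member of a disjoint family is nonzero; this drives the
    inductions on [KM]. *)
Lemma disjoint_sum (ys : seq (nat -> R)) i :
  (forall a b, (a < size ys)%N -> (b < size ys)%N -> a <> b ->
    forall i, nth (fun _ => 0) ys a i <> 0 -> nth (fun _ => 0) ys b i = 0) ->
  \sum_(y <- ys) y i = 0 \/ exists2 y, y \in ys & \sum_(y <- ys) y i = y i.
Proof.
move=> dis; rewrite (big_nth (fun _ => 0)) big_mkord.
have [/existsP[a /eqP a0]|/existsPn h] :=
  boolP [exists a : 'I_(size ys), nth (fun _ => 0) ys a i != 0]; last first.
  by left; apply: big1 => a _; apply/eqP; have := h a; rewrite negbK.
right; exists (nth (fun _ => 0) ys a); first exact: mem_nth.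
rewrite (bigD1 a)//= big1 ?addr0// => b ba.
by apply: (dis a b) => // /val_inj ab; rewrite ab eqxx in ba.
Qed.

Lemma KM_fin_supp q r y : KM q r y -> exists N, forall i, (N <= i)%N -> y i = 0.
Proof.
elim=> [n s _|ys _ _ ih _].
  by exists n.+1 => i ni; rewrite gtn_eqF.
suff [N hN] : exists N, forall y i, y \in ys -> (N <= i)%N -> y i = 0.
  by exists N => i Ni; rewrite big1_seq ?mulr0// => z /= zy; exact: hN.
elim: ys ih => [_|z ys IH ih]; first by exists 0%N.
have [|N hN] := IH; first by move=> t ty; apply: ih; rewrite inE ty orbT.
have [M hM] := ih z (mem_head _ _).
exists (maxn M N) => t i; rewrite inE geq_max => /orP[/eqP->|ty] /andP[Mi Ni].
  exact: hM.
exact: hN.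
Qed.

(** The exponent [m] is the depth of the coordinate [i] in the construction tree of [y]: each
    combination multiplies its entry by r^(-1/q). *)
Lemma KM_level q r y i : (0 < r)%N -> KM q r y ->
  y i = 0 \/ exists m : nat, `|y i| = r%:R `^ (- (m%:R / q)).
Proof.
move=> r0; elim=> [n s hs|ys _ _ ih dis].
  case: eqP => _; last by left.
  right; exists 0%N; rewrite mul0r oppr0 powRr0.
  by case: hs => ->; rewrite ?normrN normr1.
have [->|[t tys ->]] := disjoint_sum i dis; first by left; rewrite mulr0.
have [->|[m hm]] := ih t tys; first by left; rewrite mulr0.
right; exists m.+1; rewrite normrM hm ger0_norm ?powR_ge0// -powRD; last first.
  by rewrite pnatr_eq0 -lt0n r0 implybT.
by congr (_ `^ _); rewrite -natr1; ring.
Qed.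

(** A combination divides the q-th powers by r and adds at most r disjoint families of them, so the
    bound 1 is preserved. *)
Lemma KM_sum q r y N : 0 < q -> (0 < r)%N -> KM q r y ->
  \sum_(0 <= i < N) `|y i| `^ q <= 1.
Proof.
move=> q0 r0; elim=> [n s hs|ys /andP[s0 sr] _ ih dis].
  have [nN|Nn] := ltnP n N; last first.
    rewrite big_nat_cond big1 ?ler01// => i /andP[/andP[_ iN] _].
    by rewrite ltn_eqF ?(leq_trans iN)// normr0 powR0// gt_eqF.
  rewrite big_mkord (bigD1 (Ordinal nN))//= eqxx big1 ?addr0; last first.
    by move=> i; rewrite -val_eqE/= => /negbTE->; rewrite normr0 powR0// gt_eqF.
  by case: hs => ->; rewrite ?normrN normr1 powR1.
have le1 i : `|r%:R `^ (- q^-1) * \sum_(y <- ys) y i| `^ q <=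
    r%:R^-1 * \sum_(y <- ys) `|y i| `^ q.
  rewrite normrM powRM// ger0_norm ?powR_ge0// -powRrM mulNr mulVf ?gt_eqF//.
  rewrite powR_inv1// ler_wpM2l// ?invr_ge0//.
  have [->|[t tys ->]] := disjoint_sum i dis.
    by rewrite normr0 powR0 ?gt_eqF// sumr_ge0// => j _; rewrite powR_ge0.
  by rewrite (big_rem t)//= lerDl sumr_ge0// => j _; rewrite powR_ge0.
apply: (@le_trans _ _ (r%:R^-1 * \sum_(y <- ys) \sum_(0 <= i < N) `|y i| `^ q)).
  by rewrite exchange_big/= mulr_sumr ler_sum.
rewrite mulrC ler_pdivrMr ?ltr0n// mul1r (@le_trans _ _ (size ys)%:R) ?ler_nat//.
rewrite -sum1_size natr_sum big_seq [leRHS]big_seq.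
by apply: ler_sum => t /ih.
Qed.

Lemma KM_lpnorm q r y : 0 < q -> (0 < r)%N -> KM q r y -> lpnorm q y <= 1.
Proof.
move=> q0 r0 yK; have [N yN] := KM_fin_supp yK.
rewrite (lpnorm_fin_supp q0 yN) [leRHS](_ : 1 = 1 `^ q^-1); last by rewrite powR1.
rewrite ge0_ler_powR ?invr_ge0 ?nnegrE ?(ltW q0)//; last exact: KM_sum yK.
by rewrite sumr_ge0// => j _; rewrite powR_ge0.
Qed.

Section conjugate.
Variables (p q : R) (r : nat).
Hypotheses (p0 : 0 < p) (q0 : 0 < q) (pq : p^-1 + q^-1 = 1) (r0 : (0 < r)%N).

Lemma inner_le_lpnorm x y : in_lp p x -> KM q r y -> inner x y <= lpnorm p x.
Proof.
move=> xp yK; have [N yN] := KM_fin_supp yK; rewrite (inner_fin_supp _ yN).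
apply: (@le_trans _ _ (lpnorm p x * lpnorm q y)).
  apply: le_trans (hoelder_fin_supp p0 q0 pq xp yN).
  by apply: ler_sum => i _; exact: ler_norm.
by rewrite ler_piMr ?lpnorm_ge0// (KM_lpnorm q0 r0 yK).
Qed.

Lemma tnorm_ge x y : in_lp p x -> KM q r y -> inner x y <= tnorm p q r x.
Proof.
move=> xp yK; apply: sup_ubound; last by exists y.
by exists (lpnorm p x) => _ [z [zK ->]]; exact: inner_le_lpnorm.
Qed.

Lemma tnorm_le x c : (forall y, KM q r y -> inner x y <= c) -> tnorm p q r x <= c.
Proof.
move=> xc; apply: sup_le_ub; last by move=> _ [y [yK ->]]; exact: xc.
(* The supremum is over a nonempty set: it contains the pairing with the first unit vector. *)
by eexists; eexists; split; [exact: (KM_unit _ _ 0 (or_introl erefl))|].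
Qed.

Lemma tnorm_le_lpnorm x : in_lp p x -> tnorm p q r x <= lpnorm p x.
Proof. by move=> xp; apply: tnorm_le => y; exact: inner_le_lpnorm. Qed.

Lemma tnormD x z : in_lp p x -> in_lp p z ->
  tnorm p q r (fun i => x i + z i) <= tnorm p q r x + tnorm p q r z.
Proof.
move=> xp zp; apply: tnorm_le => y yK; have [N yN] := KM_fin_supp yK.
rewrite (inner_fin_supp _ yN); under eq_bigr do rewrite mulrDl.
by rewrite big_split/= -!(inner_fin_supp _ yN) lerD// tnorm_ge.
Qed.

Lemma tnormZ x c : 0 < c -> in_lp p x ->
  tnorm p q r (fun i => c * x i) = c * tnorm p q r x.
Proof.
have le d z : 0 < d -> in_lp p z ->
    tnorm p q r (fun i => d * z i) <= d * tnorm p q r z.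
  move=> d0 zp; apply: tnorm_le => y yK; have [N yN] := KM_fin_supp yK.
  rewrite (inner_fin_supp _ yN); under eq_bigr do rewrite -mulrA.
  by rewrite -mulr_sumr -(inner_fin_supp _ yN) ler_pM2l// tnorm_ge.
move=> c0 xp; apply/eqP; rewrite eq_le le//=.
(* The reverse inequality is the same one for the scalar [c^-1] and the vector [c * x]. *)
rewrite -ler_pdivlMl//; apply: le_trans (le _ _ _ (lpnormZ c p0 xp).1); last first.
  by rewrite invr_gt0.
rewrite (_ : (fun i => _) = x)//; apply/funext => i.
by rewrite mulrA mulVf ?mul1r// gt_eqF.
Qed.
End conjugate.
End Norming.

(** * Kraft's inequality *)

Section Kraft.
Context {R : realType}.
Variables (q : R) (r : nat).
Hypothesis r1 : (1 < r)%N.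

Let r_gt0 : 0 < r%:R :> R. Proof. by rewrite ltr0n ltnW. Qed.

(** Disjointness in the form of a count passes easily to permutations and sublists; this converts it
    to the indexed form of [KM_comb]. *)
Lemma count_le1_disjoint (l : seq (nat -> R)) :
  (forall i, (count (fun y : nat -> R => y i != 0%R) l <= 1)%N) ->
  forall a b, (a < size l)%N -> (b < size l)%N -> a <> b ->
    forall i, nth (fun _ => 0) l a i <> 0 -> nth (fun _ => 0) l b i = 0.
Proof.
move=> cl; suff h a b i : (a < b < size l)%N ->
    nth (fun _ => 0) l a i <> 0 -> nth (fun _ => 0) l b i = 0.
  move=> a b al bl /eqP; rewrite neq_ltn => /orP[ab|ba] i ai.
    by apply: (h a b) => //; rewrite ab.
  by apply: contra_notP ai => /(h b a i); apply; rewrite ba.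
move=> /andP[ab bl] /eqP ai; apply/eqP; apply: contraTT (cl i) => bi.
(* Cutting [l] at [b] exhibits two members that are nonzero at [i], one on each side. *)
rewrite -ltnNge -(cat_take_drop b l) count_cat (drop_nth (fun _ => 0) bl)/= bi.
rewrite addnCA add1n ltnS addn_gt0 -has_count; apply/orP; left.
apply/hasP; exists (nth (fun _ => 0) l a) => //.
by rewrite -(nth_take _ ab) mem_nth// size_take bl.
Qed.

(* Converse Kraft inequality for r-ary codes: the leaves of maximal depth are merged, at
   most r at a time, into a single vector one level higher. *)
Lemma KM_kraft (l : seq ((nat -> R) * nat)) : l != [::] ->
  (forall t : (nat -> R) * nat, t \in l -> KM q r t.1) ->
  (forall i, (count (fun t : (nat -> R) * nat => t.1 i != 0%R) l <= 1)%N) ->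
  \sum_(t <- l) r%:R ^- t.2 <= 1 :> R ->
  KM q r (fun i => \sum_(t <- l) r%:R `^ (- (t.2%:R / q)) * t.1 i).
Proof.
(* Induction on the total depth, which every merging lowers. *)
have [n] := ubnP (\sum_(t <- l) t.2)%N; elim: n l => // n IH l ln l0 lK lc lr.
pose D := (\max_(t <- l) t.2)%N.
have leD (t : (nat -> R) * nat) : t \in l -> (t.2 <= D)%N.
  by move=> tl; rewrite /D (big_rem t)//= leq_maxl.
(* At depth 0 the Kraft sum is the number of leaves, so there is only one. *)
have [D0|D0] := posnP D.
  have {}leD (t : (nat -> R) * nat) : t \in l -> t.2 = 0%N by move=> /leD; rewrite D0 leqn0 => /eqP.
  clear D D0 ln; case: l l0 lK lc lr leD => // t [|u l] _ lK _ lr m0.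
    rewrite (_ : (fun i => _) = t.1); first by apply: lK; rewrite mem_head.
    apply/funext => i; rewrite big_seq1 m0 ?mem_head//.
    by rewrite mul0r oppr0 powRr0 mul1r.
  exfalso; move: lr; rewrite !big_cons leNgt => /negP; apply.
  rewrite !m0 ?inE ?eqxx ?orbT// expr0 invr1 addrA.
  have : 0 <= \sum_(t <- l) r%:R ^- t.2 :> R.
    by rewrite sumr_ge0// => v _; rewrite invr_ge0 exprn_ge0// ltW.
  lra.
pose P (t : (nat -> R) * nat) := t.2 == D.
have hasP : has P l.
  apply: contraT => /hasPn nP; suff : (D <= D.-1)%N by rewrite -ltnS prednK// ltnn.
  apply/bigmax_leqP_seq => t tl _; rewrite -ltnS prednK// ltn_neqAle leD// andbT.
  exact: nP.
(* [A] is the group of leaves of maximal depth [D] to be merged, [B] is everything else. *)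
pose A := take r (seq.filter P l); pose B := drop r (seq.filter P l) ++ seq.filter (predC P) l.
have lAB : perm_eq l (A ++ B).
  by rewrite catA cat_take_drop perm_sym; exact/permPl/perm_filterC.
have lE (T : nmodType) (F : (nat -> R) * nat -> T) :
    \sum_(t <- l) F t = \sum_(t <- A) F t + \sum_(t <- B) F t.
  by rewrite (perm_big _ lAB) big_cat.
have AD t : t \in A -> t.2 = D.
  by move=> /mem_take; rewrite mem_filter => /andP[/eqP].
have Al t : t \in A -> t \in l by rewrite (perm_mem lAB) mem_cat => ->.
have Bl t : t \in B -> t \in l by move=> tB; rewrite (perm_mem lAB) mem_cat tB orbT.
have A0 : (0 < size A)%N.
  by rewrite size_take size_filter; case: ifP => _; rewrite -?has_count// ltnW.
have Ar : (size A <= r)%N by rewrite size_take; case: ltnP.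
have sumA (T : nmodType) (F : nat -> T) : \sum_(t <- A) F t.2 = F D *+ size A.
  by rewrite (eq_big_seq (fun=> F D)) ?big_const_seq ?count_predT ?iter_addr_0// => t /AD->.
have DE : D = D.-1.+1 by rewrite prednK.
have r0 := gt_eqF r_gt0.
pose y i := r%:R `^ (- q^-1) * \sum_(z <- [seq t.1 | t <- A]) z i.
have cA i : (count (fun t : (nat -> R) * nat => t.1 i != 0%R) A <= 1)%N.
  by apply: leq_trans (lc i); rewrite (permP lAB) count_cat leq_addr.
have yK : KM q r y.
  apply: KM_comb; first by rewrite size_map A0.
    by move=> z /mapP[t /Al tl ->]; exact: lK.
  by apply: count_le1_disjoint => i; rewrite count_map; exact: cA.
have y0 i : y i != 0 -> (0 < count (fun t : (nat -> R) * nat => t.1 i != 0%R) A)%N.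
  apply: contraTT; rewrite -has_count => /hasPn nA; rewrite negbK /y big_map.
  by rewrite big_seq big1 ?mulr0// => t /nA; rewrite negbK => /eqP.
have := IH ((y, D.-1) :: B); rewrite big_cons/=.
have -> : (fun i => \sum_(t <- (y, D.-1) :: B) r%:R `^ (- (t.2%:R / q)) * t.1 i) =
    (fun i => \sum_(t <- l) r%:R `^ (- (t.2%:R / q)) * t.1 i).
  apply/funext => i; rewrite big_cons lE; congr (_ + _) => /=.
  rewrite /y mulrA -powRD ?r0 ?implybT// big_map mulr_sumr.
  apply: eq_big_seq => t /AD ->; congr (_ `^ _ * _).
  by rewrite [in RHS]DE -natr1; ring.
apply => //.
- rewrite -ltnS; apply: leq_trans ln; rewrite ltnS lE.
  have -> : (\sum_(t <- A) t.2 = D * size A)%N.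
    rewrite (eq_big_seq (fun=> D)); last by move=> t /AD.
    by rewrite big_const_seq count_predT iter_addn_0.
  by rewrite ltn_add2r; apply: (@leq_trans D); [rewrite [ltnRHS]DE|rewrite leq_pmulr].
- by move=> t; rewrite inE => /orP[/eqP->//|/Bl]; exact: lK.
- move=> i; have := lc i; rewrite (permP lAB) count_cat; have := y0 i.
  by case: (y i != 0%R) => [/(_ isT)|_] /=; lia.
rewrite big_cons/=; have [Ar'|rA] := ltnP (size A) r; last first.
  (* A full group contributes r times r^-D, which is r^-(D-1): the Kraft sum does not change. *)
  have {Ar rA}Ar : size A = r by apply/eqP; rewrite eqn_leq Ar.
  move: lr; rewrite lE (sumA _ (fun m => r%:R ^- m)) Ar; congr (_ + _ <= _).
  by rewrite {1}DE exprS invfM -[LHS]mulr_natr mulrAC mulVf ?mul1r ?r0.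
(* A group of fewer than r leaves exhausts the depth D. The Kraft sum of the rest is then a multiple
   of r^-(D-1) below 1, which leaves room for the merged leaf. *)
have BD t : t \in B -> (t.2 <= D.-1)%N.
  rewrite mem_cat => /orP[|].
    have [rs|sr] := ltnP r (size (seq.filter P l)); last by rewrite drop_oversize.
    by move: Ar'; rewrite /A size_take rs ltnn.
  rewrite mem_filter /= => /andP[tD /leD]; rewrite leq_eqVlt -/(P t) (negbTE tD)/=.
  by rewrite {1}DE ltnS.
have B1 : \sum_(t <- B) r%:R ^- t.2 < 1 :> R.
  apply: lt_le_trans lr; rewrite lE ltrDr (sumA _ (fun m => r%:R ^- m)).
  by rewrite pmulrn_lgt0// invr_gt0 exprn_gt0.
have BE : \sum_(t <- B) r%:R ^- t.2 = (\sum_(t <- B) r ^ (D.-1 - t.2))%:R / r%:R ^+ D.-1 :> R.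
  rewrite natr_sum mulr_suml; apply: eq_big_seq => t /BD tD.
  by rewrite natrX expfB_cond ?r0// mulrAC divff ?mul1r ?expf_eq0 ?r0 ?andbF.
rewrite BE in B1 *; rewrite -[X in X + _]mul1r -mulrDl nat1r.
rewrite ltr_pdivrMr ?exprn_gt0// mul1r -natrX ltr_nat in B1.
by rewrite ler_pdivrMr ?exprn_gt0// mul1r -natrX ler_nat.
Qed.
End Kraft.

(** * Distribution of mass over the scales modulo r *)

Section Profile.
Context {R : realType}.
Variables (p rho : R) (k : nat).
Hypotheses (p0 : 0 < p) (rho1 : 1 < rho).
Implicit Types (f g y : nat -> R) (M : 'I_k.+1 -> R) (E : nat -> int) (z : int).

(** Values in ['I_k.+1] carry addition modulo [k.+1], so a shift of classes is ordinal addition. In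
    the theorem [k.+1] is the integer part of log_2 r. *)
Definition residue z : 'I_k.+1 := inord `|(z %% k.+1%:Z)%Z|.

Lemma residueE z : (residue z)%:Z = (z %% k.+1%:Z)%Z.
Proof.
have z0 : (0 <= z %% k.+1%:Z)%Z by rewrite modz_ge0.
by rewrite /residue inordK ?gez0_abs// -ltz_nat gez0_abs// ltz_pmod.
Qed.

Lemma residueD z z' : residue (z + z') = residue z + residue z'.
Proof.
apply/val_inj/eqP; rewrite -eqz_nat residueE /= -modz_nat PoszD !residueE.
by rewrite modzDm.
Qed.

Lemma residue_ord (i : 'I_k.+1) : residue i%:Z = i.
Proof.
by apply/val_inj/eqP; rewrite -eqz_nat residueE modz_nat eqz_nat modn_small.
Qed.

Lemma residueN z : residue (- z) = - residue z.
Proof.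
apply/eqP; rewrite -addr_eq0 -residueD addNr; apply/eqP.
exact: (residue_ord ord0).
Qed.

Let rho0 : 0 < rho. Proof. exact: lt_trans rho1. Qed.
Let rhoN0 : rho != 0. Proof. by rewrite gt_eqF. Qed.

Lemma powR_intD (a b : int) :
  rho `^ (a + b)%:~R = rho `^ a%:~R * rho `^ b%:~R.
Proof. by rewrite intrD powRD// rhoN0 implybT. Qed.

Lemma exists_level (v : R) : 0 < v -> exists t : int,
  rho `^ t%:~R <= v <= rho `^ (t + 1)%:~R.
Proof.
move=> v0; have l0 : 0 < ln rho by rewrite ln_gt0.
have vE : v = rho `^ (ln v / ln rho).
  by rewrite /powR (negbTE rhoN0) divfK ?gt_eqF// lnK.
have /andP[h1 h2] := floor_itv (ln v / ln rho).
exists (Num.floor (ln v / ln rho)); rewrite [X in _ <= X <= _]vE.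
by rewrite !ler_powR ?(ltW rho1) ?(ltW h2)// h1.
Qed.

(* The window [L0, L1) contains the support of f, the p-th power of |f c| is known up to
   a factor rho ^ w from its level E c, and M s is the p-mass carried by the levels
   congruent to s modulo k.+1, i.e. by the scales in rho ^ s * r ^ Z. *)
Definition profile (L0 L1 w : nat) f M := exists E,
  [/\ forall c, f c != 0 -> (L0 <= c < L1)%N,
      forall c, f c != 0 ->
        rho `^ (E c)%:~R <= `|f c| `^ p <= rho `^ (E c + w%:Z)%:~R &
      forall s, \sum_(0 <= c < L1 | residue (E c) == s) `|f c| `^ p = M s].

Let powR_norm0 : `|0 : R| `^ p = 0.
Proof. by rewrite normr0 powR0// gt_eqF. Qed.

Lemma profile_ge0 L0 L1 w f M s : profile L0 L1 w f M -> 0 <= M s.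
Proof. by case=> E [_ _ <-]; rewrite sumr_ge0// => c _; rewrite powR_ge0. Qed.

Lemma profile_supp L0 L1 w f M c : profile L0 L1 w f M -> (L1 <= c)%N -> f c = 0.
Proof.
case=> E [supp _ _] Lc; apply/eqP; apply: contraT => /supp /andP[_].
by rewrite ltnNge Lc.
Qed.

Lemma profile_sum L0 L1 w f M : profile L0 L1 w f M ->
  \sum_(0 <= c < L1) `|f c| `^ p = \sum_s M s.
Proof.
case=> E [_ _ M_E]; under [RHS]eq_bigr do rewrite -M_E.
by rewrite (partition_big (residue \o E) predT).
Qed.

Lemma profile_exists L0 L1 f : (forall c, f c != 0 -> (L0 <= c < L1)%N) ->
  exists M, profile L0 L1 1 f M.
Proof.
move=> supp.
have /choice[E hE] : forall c, exists t : int, f c != 0 ->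
    rho `^ t%:~R <= `|f c| `^ p <= rho `^ (t + 1)%:~R.
  (* A zero coordinate gets the level 0 and adds no mass to that class. *)
  move=> c; have [->|fc] := eqVneq (f c) 0; first by exists 0.
  have [|t ht] := @exists_level (`|f c| `^ p); last by exists t.
  by rewrite powR_gt0// normr_gt0.
by eexists; exists E; split => //.
Qed.

Lemma profile0 L0 L1 w : profile L0 L1 w (fun _ => 0) (fun _ => 0).
Proof.
exists (fun _ => 0); split => [c|c|s]; rewrite ?eqxx//.
by apply: big1 => c _.
Qed.

(** Adjacent windows make the supports disjoint: each coordinate keeps its level and the masses add
    class by class. *)
Lemma profileD L0 L1 L2 w f g M M' : (L0 <= L1 <= L2)%N ->
  profile L0 L1 w f M -> profile L1 L2 w g M' ->
  profile L0 L2 w (fun c => f c + g c) (fun s => M s + M' s).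
Proof.
move=> /andP[L01 L12] [E [sf Ef Mf]] [E' [sg Eg Mg]].
have f0 c : (L1 <= c)%N -> f c = 0.
  by move=> Lc; apply/eqP; apply: contraT => /sf; rewrite ltnNge Lc andbF.
have g0 c : (c < L1)%N -> g c = 0.
  by move=> cL; apply/eqP; apply: contraT => /sg; rewrite leqNgt cL.
exists (fun c => if (c < L1)%N then E c else E' c); split.
- move=> c; have [cL|Lc] := ltnP c L1.
    by rewrite g0// addr0 => /sf /andP[-> _]; exact: leq_trans cL L12.
  by rewrite f0// add0r => /sg /andP[_ ->]; rewrite (leq_trans L01).
- move=> c; have [cL|Lc] := ltnP c L1; first by rewrite g0// addr0; exact: Ef.
  by rewrite f0// add0r; exact: Eg.
move=> s; rewrite (big_cat_nat (n := L1))//=; congr (_ + _).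
  rewrite -Mf big_nat_cond [RHS]big_nat_cond; apply: eq_big => c /=.
    by case: (ltnP c L1) => //; rewrite ?andbF.
  by move=> /andP[cL _]; rewrite g0// addr0.
rewrite -Mg [RHS](big_cat_nat (n := L1))//= [X in _ = X + _]big_nat_cond.
rewrite [X in _ = X + _]big1 ?add0r; last first.
  by move=> c /andP[/andP[_ cL] _]; rewrite g0// powR_norm0.
rewrite big_nat_cond [RHS]big_nat_cond; apply: eq_big => c /=.
  by case: (ltnP c L1) => //; rewrite ?andbF.
by move=> /andP[/andP[Lc _] _]; rewrite f0// add0r.
Qed.

(** Levels are approximate, so those of the multiple may be declared to be [E c + t]. The masses are
    then shifted exactly, and the price is only the increase of the width by [d]. *)
Lemma profileZ L0 L1 w d f M (a : R) (t : int) :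
  rho `^ t%:~R <= `|a| `^ p <= rho `^ (t + d%:Z)%:~R ->
  profile L0 L1 w f M ->
  profile L0 L1 (w + d) (fun c => a * f c) (fun s => `|a| `^ p * M (s - residue t)).
Proof.
move=> /andP[ta at_] [E [sf Ef Mf]]; exists (fun c => E c + t); split.
- by move=> c; rewrite mulf_eq0 negb_or => /andP[_ /sf].
- move=> c; rewrite mulf_eq0 negb_or => /andP[_ /Ef /andP[h1 h2]].
  rewrite normrM powRM// PoszD (addrC (E c) t).
  have -> : t + E c + (w%:Z + d%:Z) = (t + d%:Z) + (E c + w%:Z) by ring.
  by rewrite (powR_intD t (E c)) (powR_intD _ (E c + w%:Z)) !ler_pM ?powR_ge0.
move=> s; rewrite -Mf mulr_sumr; apply: eq_big => c.
  by rewrite residueD -[in RHS](inj_eq (addIr (residue t))) subrK.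
by move=> _; rewrite normrM powRM.
Qed.

End Profile.

(** * Pairing a vector of given class masses with the norming set *)

Section ProfileNorm.
Context {R : realType}.
Variables (p q rho : R) (r k : nat).
Hypotheses (p0 : 0 < p) (q0 : 0 < q) (pq : p^-1 + q^-1 = 1) (rho1 : 1 < rho)
  (r1 : (1 < r)%N) (rhok : rho `^ k.+1%:R = r%:R).
Implicit Types (f g y : nat -> R) (M : 'I_k.+1 -> R) (E : nat -> int) (z : int).

Let rho0 : 0 < rho. Proof. exact: lt_trans rho1. Qed.
Let rhoN0 : rho != 0. Proof. by rewrite gt_eqF. Qed.
Let pV0 : 0 < p^-1. Proof. by rewrite invr_gt0. Qed.
Let qV0 : 0 < q^-1. Proof. by rewrite invr_gt0. Qed.

Lemma residue_decomp z : z = (residue k z)%:Z + (z %/ k.+1%:Z)%Z * k.+1%:Z.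
Proof. by rewrite residueE addrC -divz_eq. Qed.

Lemma powR_rhok (x : R) : r%:R `^ x = rho `^ (k.+1%:R * x).
Proof. by rewrite -rhok -powRrM. Qed.

Lemma powR_pK (x : R) : 0 <= x -> (x `^ p) `^ p^-1 = x.
Proof. by move=> x0; rewrite -powRrM divff ?gt_eqF// powRr1. Qed.

(* Write z = s + h (k+1) with s the residue of z.  If m + h >= 0 then the weight b is at most
   rho ^ (- s / q) times the extremal one a ^ (p / q); otherwise b ^ q >= rho ^ (- w) a ^ p. *)
Lemma level_pairing_le (a b : R) (w m : nat) (z : int) : 0 <= a ->
  rho `^ z%:~R <= a `^ p <= rho `^ (z + w%:Z)%:~R ->
  b = r%:R `^ (- (m%:R / q)) ->
  a * b <= rho `^ (- ((residue k z)%:R / q)) * a `^ p + rho `^ (w%:R / p) * b `^ q.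
Proof.
move=> a0 /andP[za az] bE; have b0 : 0 <= b by rewrite bE powR_ge0.
have zE : z%:~R = (residue k z)%:R + (z %/ k.+1%:Z)%Z%:~R * k.+1%:R :> R.
  by rewrite {1}(residue_decomp z) intrD intrM.
have [mh|mh] := lerP 0 (m%:Z + (z %/ k.+1%:Z)%Z).
  apply: ler_wpDr; first by rewrite mulr_ge0 ?powR_ge0.
  (* This is p = 1 + p/q. *)
  have -> : a `^ p = a * (a `^ p) `^ q^-1.
    rewrite -{2}(powR_pK a0) -powRD ?pq ?powRr1 ?powR_ge0//.
    by rewrite oner_eq0.
  rewrite mulrCA ler_wpM2l//.
  apply: (@le_trans _ _ (rho `^ (- ((residue k z)%:R / q)) * (rho `^ z%:~R) `^ q^-1)).
    rewrite -powRrM -powRD ?rhoN0 ?implybT// bE powR_rhok ler_powR ?(ltW rho1)//.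
    rewrite zE -!mulNr -mulrDl mulrA ler_pM2r// addrA addNr add0r mulrN lerNl.
    rewrite -mulNr mulrC ler_pM2l ?ltr0n// -mulrNz.
    by rewrite (_ : m%:R = m%:Z%:~R)// ler_int; move: mh; clear; lia.
  by apply: ler_wpM2l; [exact: powR_ge0|exact: le_powR (ltW qV0) (powR_ge0 _ _) za].
apply: ler_wpDl; first by rewrite mulr_ge0 ?powR_ge0.
have bb : b = b `^ (1 - q) * b `^ q.
  by rewrite -powRD ?subrK ?powRr1// oner_eq0.
rewrite [X in a * X]bb mulrA ler_wpM2r ?powR_ge0// -[X in X * _](powR_pK a0).
apply: (@le_trans _ _ ((rho `^ (z + w%:Z)%:~R) `^ p^-1 * b `^ (1 - q))).
  by apply: ler_wpM2r; [exact: powR_ge0|exact: le_powR (ltW pV0) (powR_ge0 _ _) az].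
rewrite bE powR_rhok -!powRrM -powRD ?rhoN0 ?implybT// ler_powR ?(ltW rho1)//.
have -> : k.+1%:R * - (m%:R / q) * (1 - q) = k.+1%:R * m%:R / p :> R.
  have -> : p^-1 = 1 - q^-1 by rewrite -pq addrK.
  by field; rewrite gt_eqF.
rewrite -mulrDl ler_pM2r// intrD addrAC gerDr.
have -> : z%:~R + k.+1%:R * m%:R = (z + k.+1%:Z * m%:Z)%:~R :> R.
  by rewrite intrD intrM.
(* Here m + h <= -1 while the residue s is at most k, so s + (m + h)(k+1) is negative. *)
rewrite lerz0 {1}(residue_decomp z) -addrA mulrC -mulrDr.
have : ((residue k z)%:Z < k.+1%:Z) by rewrite ltz_nat.
by move: mh; clear; nia.
Qed.

(** Sum [level_pairing_le] over the coordinates: grouped by class, the first terms give the weighted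
    masses, and [KM_sum] bounds the second ones. *)
Lemma inner_profile_le L0 L1 w f M y : profile p rho L0 L1 w f M -> KM q r y ->
  inner f y <= \sum_(s < k.+1) rho `^ (- (s%:R / q)) * M s + rho `^ (w%:R / p).
Proof.
move=> [E [sf Ef Mf]] yK; have [N0 yN0] := KM_fin_supp yK.
pose N := maxn N0 L1; have yN i : (N <= i)%N -> y i = 0.
  by rewrite geq_max => /andP[/yN0].
have f0 c : (L1 <= c)%N -> f c = 0.
  by move=> Lc; apply/eqP; apply: contraT => /sf; rewrite ltnNge Lc andbF.
rewrite (inner_fin_supp _ yN).
apply: (@le_trans _ _ (\sum_(0 <= c < N)
    (rho `^ (- ((residue k (E c))%:R / q)) * `|f c| `^ p + rho `^ (w%:R / p) * `|y c| `^ q))).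
  apply: ler_sum => c _; apply: le_trans (ler_norm _) _; rewrite normrM.
  have [->|fc] := eqVneq (f c) 0.
    by rewrite normr0 mul0r addr_ge0// mulr_ge0// powR_ge0.
  have [->|[m hm]] := KM_level c (ltnW r1) yK.
    by rewrite normr0 mulr0 addr_ge0// mulr_ge0// powR_ge0.
  by apply: (@level_pairing_le `|f c| `|y c| w m (E c)) => //; exact: Ef.
rewrite big_split/= lerD//; last first.
  rewrite -mulr_sumr ler_piMr ?powR_ge0//; exact: (KM_sum _ q0 (ltnW r1) yK).
rewrite (big_cat_nat (n := L1))//= ?leq_maxr// [X in _ + X]big_nat_cond.
rewrite [X in _ + X]big1 ?addr0; last first.
  move=> c /andP[/andP[Lc _] _]; rewrite f0// normr0 powR0 ?mulr0//.
  by rewrite gt_eqF.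
rewrite (partition_big (residue k \o E) predT)//= ler_sum// => s _.
by rewrite -Mf mulr_sumr ler_sum// => c /eqP ->.
Qed.

(** The test vector lives on the class 0. There a level is -(k+1) m, and the weight r^(-m/q), with
    the sign of [f c], matches |f c|^(p/q) up to rho^(w/q). Kraft's sum is at most M 0 <= 1. *)
Lemma inner_profile_ge L0 L1 w f M : profile p rho L0 L1 w f M ->
  0 < M 0 -> M 0 <= 1 ->
  exists2 y, KM q r y & rho `^ (- (w%:R / q)) * M 0 <= inner f y.
Proof.
move=> [E [sf Ef Mf]] M0 M1.
pose P c := (residue k (E c) == 0) && (f c != 0).
pose m c := `|(E c %/ k.+1%:Z)%Z|%N.
pose unit_vec c : nat -> R := fun i => if i == c then Num.sg (f c) else 0.
pose S := [seq c <- index_iota 0 L1 | P c].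
pose l := [seq (unit_vec c, m c) | c <- S].
have sumS (F : nat -> R) : \sum_(c <- S) F c = \sum_(0 <= c < L1 | P c) F c.
  by rewrite big_filter.
have ME : \sum_(c <- S) `|f c| `^ p = M 0.
  rewrite -Mf sumS big_mkcondr/=; apply: eq_bigr => c _.
  by have [->|//] := eqVneq (f c) 0; rewrite normr0 powR0// gt_eqF.
have PS c : c \in S -> P c by rewrite mem_filter => /andP[].
have fM c : c \in S -> `|f c| `^ p <= 1.
  move=> cS; apply: le_trans M1; rewrite -ME (big_rem c)//= lerDl.
  by rewrite sumr_ge0// => ? _; rewrite powR_ge0.
(* The level is divisible by [k.+1] because its residue is 0, and nonpositive because |f c|^p <= 1;
   so the absolute value in [m] only changes the sign. *)
have Em c : c \in S -> E c = - (k.+1%:Z * (m c)%:Z).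
  move=> cS; have /andP[/eqP rc fc] := PS c cS.
  have Ek := residue_decomp (E c); rewrite rc add0r in Ek.
  have E0 : E c <= 0.
    rewrite leNgt; apply/negP => E0; have /andP[Ec _] := Ef c fc.
    have := le_trans Ec (fM c cS); rewrite leNgt => /negP; apply.
    rewrite (lt_le_trans rho1)// -[leLHS]powRr1 ?(ltW rho0)//.
    by apply: ler_powR; rewrite ?(ltW rho1)// ler1z.
  have h0 : (E c %/ k.+1%:Z)%Z <= 0 by move: E0; rewrite Ek; clear; nia.
  by rewrite /m lez0_abs// mulrN opprK mulrC.
have rm c : c \in S -> r%:R ^- m c = rho `^ (E c)%:~R.
  move=> cS; rewrite -powR_invn// powR_rhok Em//.
  by rewrite mulrN mulrNz intrM.
have yK : KM q r (fun i => \sum_(t <- l) r%:R `^ (- (t.2%:R / q)) * t.1 i).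
  apply: KM_kraft => //.
  - apply: contraTneq M0 => l0; rewrite -ME (_ : S = [::]) ?big_nil ?ltxx//.
    by apply/size0nil; rewrite -(size_map (fun c => (unit_vec c, m c))) -/l l0.
  - move=> t /mapP[c cS ->]/=; apply: KM_unit.
    have /andP[_ fc] := PS c cS.
    by move: fc; rewrite neq_lt => /orP[/ltr0_sg|/gtr0_sg] ->; [right|left].
  - move=> i; rewrite count_map.
    have uS : uniq S by rewrite filter_uniq// iota_uniq.
    apply: (@leq_trans (count (pred1 i) S)); last by rewrite count_uniq_mem// leq_b1.
    apply: sub_count => c /=; rewrite /unit_vec.
    by case: (eqVneq i c) => //= _; rewrite eqxx.
  rewrite big_map/=; apply: le_trans M1; rewrite -ME.
  rewrite big_seq [leRHS]big_seq; apply: ler_sum => c cS.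
  by rewrite rm//; have /andP[_ fc] := PS c cS; have /andP[] := Ef c fc.
eexists; first exact: yK.
have yN i : (L1 <= i)%N -> \sum_(t <- l) r%:R `^ (- (t.2%:R / q)) * t.1 i = 0.
  move=> Li; rewrite big_map/= big_seq big1// => c cS.
  rewrite /unit_vec; case: eqP => [ic|_]; last by rewrite mulr0.
  have /andP[_ /sf/andP[_]] := PS c cS.
  by rewrite -ic ltnNge Li.
rewrite (inner_fin_supp _ yN) -ME.
under [leRHS]eq_bigr do rewrite big_map/= mulr_sumr.
rewrite [leRHS]exchange_big/= mulr_sumr big_seq [leRHS]big_seq.
apply: ler_sum => c cS; have /andP[_ fc] := PS c cS.
have cL : (c < L1)%N by have /andP[] := sf c fc.
rewrite big_mkord (bigD1 (Ordinal cL))//= big1 ?addr0; last first.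
  move=> i; rewrite -val_eqE/= /unit_vec => /negbTE ->.
  by rewrite !mulr0.
rewrite /unit_vec eqxx mulrCA (mulrC (f c)) -normrEsg.
have -> : `|f c| `^ p = (`|f c| `^ p) `^ q^-1 * `|f c|.
  rewrite -{3}(@powR_pK `|f c|)// -powRD ?(addrC q^-1) ?pq ?powRr1 ?powR_ge0//.
  by rewrite oner_eq0.
rewrite mulrA ler_wpM2r//.
have -> : rho `^ (- (w%:R / q)) = (rho `^ (- w%:R)) `^ q^-1 by rewrite -powRrM mulNr.
have -> : r%:R `^ (- ((m c)%:R / q)) = (rho `^ (E c)%:~R) `^ q^-1.
  by rewrite powR_rhok -powRrM Em// mulrNz intrM mulrN mulNr mulrA.
rewrite -powRM ?powR_ge0//; apply: le_powR; rewrite ?(ltW qV0)// ?mulr_ge0 ?powR_ge0//.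
have /andP[_ h] := Ef c fc.
rewrite powRN ler_pdivrMl ?powR_gt0// -powRD ?rhoN0 ?implybT//.
by apply: le_trans h _; rewrite intrD addrC.
Qed.

End ProfileNorm.

(** * Blocks in an infinite-dimensional subspace *)

(** The ratio b = rho^(-1/q) satisfies 1/b >= 1 + ln 2 / q >= 1 + 1/(2q), so the sum is at most
    1/(1-b) <= 2q + 1 <= 3q. *)
Lemma sum_powR_geometric {R : realType} (rho q : R) (n : nat) : 2 <= rho -> 1 < q ->
  \sum_(s < n) rho `^ (- (s%:R / q)) <= 3 * q.
Proof.
move=> rho2 q1; have q0 : 0 < q := lt_trans ltr01 q1.
have rho0 : 0 < rho := lt_le_trans (ltr0Sn _ _) rho2.
pose b := rho `^ (- q^-1).
have b0 : 0 < b by rewrite powR_gt0.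
have bs (s : nat) : rho `^ (- (s%:R / q)) = b ^+ s.
  by rewrite -powR_mulrn ?(ltW b0)// -powRrM; congr (_ `^ _); ring.
(* From ln(1+x) <= x at x = -1/2. *)
have ln2 : 2^-1 <= ln 2 :> R.
  have : ln (1 + - 2^-1) <= - 2^-1 :> R by apply: le_ln1Dx; lra.
  by rewrite (_ : 1 + - 2^-1 = 2^-1); [rewrite lnV ?posrE// lerN2|lra].
have hb : 1 + (2 * q)^-1 <= b^-1.
  rewrite -powRN opprK /powR gt_eqF//; apply: le_trans (expR_ge1Dx _).
  rewrite lerD2l invfM mulrC ler_wpM2l ?invr_ge0 ?(ltW q0)//.
  by apply: le_trans ln2 _; rewrite ler_ln ?posrE.
have {}hb : (2 * q + 1) * b <= 2 * q.
  have -> : (2 * q + 1) * b = 2 * q * (b * (1 + (2 * q)^-1)) by field; rewrite gt_eqF.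
  rewrite ler_piMr ?mulr_ge0 ?(ltW q0)//.
  by rewrite -[leRHS](@mulfV _ b) ?gt_eqF// ler_pM2l.
under eq_bigr do rewrite bs.
have := subrX1 b n; set S := \sum_(i < n) _ => bS.
have S0 : 0 <= S by rewrite sumr_ge0// => i _; rewrite exprn_ge0// ltW.
have bn : 0 <= b ^+ n by rewrite exprn_ge0// ltW.
nra.
Qed.

Section Blocks.
Context {R : realType}.
Variables (p : R) (X : set (nat -> R)).
Hypotheses (p1 : 1 < p) (Xc : closed_subspace_lp p X).

Let p0 : 0 < p. Proof. exact: lt_trans p1. Qed.

Lemma subspace_sum (I : Type) (s : seq I) (a : I -> R) (v : I -> nat -> R) :
  (forall n, X (v n)) -> X (fun i => \sum_(n <- s) a n * v n i).
Proof.
case: Xc => _ X0 XD XZ _ Xv; elim: s => [|n s IH].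
  by rewrite (_ : (fun i => _) = (fun _ => 0))//; apply/funext => i; rewrite big_nil.
rewrite (_ : (fun i => _) = (fun i => a n * v n i + \sum_(n <- s) a n * v n i)).
  by apply: (XD (fun i => a n * v n i)) => //; exact: XZ.
by apply/funext => i; rewrite big_cons.
Qed.

Hypothesis Xinf : inf_dim X.

(** L conditions on the coefficients of L+1 independent vectors leave a nonzero solution, a row of
    the left kernel. *)
Lemma inf_dim_vanishing (L : nat) : exists v, [/\ X v, exists c, v c != 0 &
  forall c, (c < L)%N -> v c = 0].
Proof.
have [v [vX indep]] := Xinf L.+1.
pose A : 'M[R]_(L.+1, L) := \matrix_(i, j) v i j.
have : kermx A != 0.
  by rewrite -mxrank_eq0 mxrank_ker subn_eq0 -ltnNge ltnS rank_leq_col.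
move=> /rowV0Pn[w /sub_kermxP wA w0].
exists (fun i => \sum_(n <- enum 'I_L.+1) w 0 n * v n i); split.
- exact: subspace_sum.
- apply: contrapT => h; move/negP: w0; apply; apply/eqP/rowP => n; rewrite mxE.
  apply: (indep (w 0)) => i; apply: contrapT => wi; apply: h; exists i.
  by rewrite big_enum; apply/eqP.
move=> c cL; have := congr1 (fun B : 'rV_L => B 0 (Ordinal cL)) wA.
rewrite !mxE => h; rewrite -[RHS]h big_enum/=.
by apply: eq_bigr => n _; rewrite mxE.
Qed.

(** A vector of X vanishing before L is cut at a far L' and scaled so that the part kept has p-mass
    1/2. *)
Lemma exists_block (L : nat) (e : R) : 0 < e -> exists v u L', [/\ X v,
  forall c, u c != 0 -> (L <= c < L')%N, \sum_(0 <= c < L') `|u c| `^ p = 2^-1,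
  in_lp p (fun c => v c - u c) & lpnorm p (fun c => v c - u c) <= e].
Proof.
move=> e0; have [v [vX [c0 vc0] vL]] := inf_dim_vanishing L.
have vp : in_lp p v by case: Xc => /(_ v vX).
have b0 : 0 < `|v c0| by rewrite normr_gt0.
(* The scaling factor a found below satisfies a |v c0| <= 1, so this tail becomes at most e. *)
have [N0 hN0] := lpnorm_tail p0 vp (mulr_gt0 e0 b0).
pose L' := maxn N0 c0.+1; have [tp tb] := hN0 L' (leq_maxl _ _).
pose S := \sum_(0 <= c < L') `|v c| `^ p.
have bS : `|v c0| `^ p <= S.
  rewrite /S big_mkord (bigD1 (Ordinal (leq_maxr N0 c0.+1)))//= lerDl.
  by rewrite sumr_ge0// => ? _; rewrite powR_ge0.
have S0 : 0 < S by rewrite (lt_le_trans _ bS)// powR_gt0.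
pose a := (2^-1 / S) `^ p^-1.
have a0 : 0 < a by rewrite powR_gt0 ?divr_gt0.
have ap : `|a| `^ p = 2^-1 / S.
  rewrite gtr0_norm// /a -powRrM mulVf ?gt_eqF// powRr1// divr_ge0 ?ltW//.
have ab : a * `|v c0| <= 1.
  rewrite leNgt; apply/negP => /(gt0_ltr_powR p0); rewrite !nnegrE ler01 mulr_ge0 ?(ltW a0)//.
  move=> /(_ isT isT); rewrite powR1 ltNge => /negP; apply.
  rewrite powRM ?(ltW a0)// -(gtr0_norm a0) ap mulrAC ler_pdivrMr// mul1r.
  by apply: le_trans bS; rewrite ler_piMl ?powR_ge0// invf_le1// ler1n.
exists (fun c => a * v c), (fun c => if (c < L')%N then a * v c else 0), L'.
have E : (fun c => a * v c - (if (c < L')%N then a * v c else 0)) =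
    (fun c => a * (if (L' <= c)%N then v c else 0)).
  by apply/funext => c; case: ltnP => _; rewrite ?subrr ?mulr0 ?subr0.
split.
- by case: Xc => _ _ _ + _; apply.
- move=> c; case: ltnP; rewrite ?eqxx// andbT => _.
  by rewrite mulf_eq0 negb_or => /andP[_]; apply: contraR; rewrite -ltnNge => /vL ->.
- rewrite (eq_big_nat _ _ (F2 := fun c => `|a| `^ p * `|v c| `^ p)).
    by rewrite -mulr_sumr ap -/S divfK// gt_eqF.
  by move=> c /andP[_ ->]; rewrite normrM powRM.
- by rewrite E; have [] := lpnormZ a p0 tp.
rewrite E; have [_ ->] := lpnormZ a p0 tp; rewrite gtr0_norm//.
apply: (@le_trans _ _ (a * (e * `|v c0|))); first by rewrite ler_pM2l.
by rewrite mulrCA ler_piMr// ltW.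
Qed.

End Blocks.

(** * Superblocks whose mass is spread evenly over the classes *)

Section EquidistributedBlocks.
Context {R : realType}.
Variables (p rho : R) (k : nat) (X : set (nat -> R)).
Hypotheses (p1 : 1 < p) (rho2 : 2 <= rho) (Xc : closed_subspace_lp p X) (Xinf : inf_dim X).
Implicit Types (e d : R) (M m : 'I_k.+1 -> R).

Let p0 : 0 < p. Proof. exact: lt_trans p1. Qed.
Let rho1 : 1 < rho. Proof. by apply: lt_le_trans rho2; rewrite ltr1n. Qed.
Let rho0 : 0 < rho. Proof. exact: lt_trans rho1. Qed.

(* v is an element of X, u its finitely supported approximation *)
Definition approx_profile (L L' : nat) (e : R) (v u : nat -> R) M :=
  [/\ X v, (L <= L')%N, profile p rho L L' 1 u M,
      in_lp p (fun c => v c - u c) & lpnorm p (fun c => v c - u c) <= e].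

Lemma approx_profileW L0 L L' e e' v u M : (L0 <= L)%N -> e <= e' ->
  approx_profile L L' e v u M -> approx_profile L0 L' e' v u M.
Proof.
move=> LL ee [vX L12 [E [sE hE mE]] ip ne]; split => //.
- exact: leq_trans L12.
- exists E; split => // c /sE /andP[Lc ->]; rewrite andbT.
  exact: leq_trans Lc.
exact: le_trans ee.
Qed.

Lemma exists_approx_profile L e : 0 < e -> exists v u L' M,
  approx_profile L L' e v u M /\ \sum_s M s = 2^-1.
Proof.
move=> e0; have [v [u [L' [vX su u1 ip ne]]]] := exists_block p1 Xc Xinf L e0.
have LL' : (L <= L')%N.
  rewrite leqNgt; apply/negP => L'L; move: u1; rewrite big_nat_cond big1.
    by move/eqP; rewrite eq_sym invr_eq0 pnatr_eq0.
  move=> c /andP[/andP[_ cL'] _].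
  have -> : u c = 0.
    apply/eqP; apply: contraT => /su /andP[Lc _].
    by have := ltn_trans (leq_ltn_trans Lc cL') L'L; rewrite ltnn.
  by rewrite normr0 powR0// gt_eqF.
have [M Mu] := profile_exists p k rho1 su.
by exists v, u, L', M; split; [split|rewrite -(profile_sum Mu)].
Qed.

(* The masses of the blocks are rounded to multiples of 1 / (4 (k+1)); one of the finitely
   many rounded vectors occurs arbitrarily far out. *)
Lemma exists_common_masses : exists m, [/\ forall s, 0 <= m s, 4^-1 <= \sum_s m s, \sum_s m s <= 2^-1 &
  forall L e, 0 < e -> exists v u L' M, approx_profile L L' e v u M /\
    forall s, m s <= M s <= m s + (4 * k.+1%:R)^-1].
Proof.
pose D : R := 4 * k.+1%:R.
have D0 : 0 < D by rewrite mulr_gt0.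
pose m (x : {ffun 'I_k.+1 -> 'I_(4 * k.+1).+1}) s : R := (x s)%:R / D.
pose good x M := forall s, m x s <= M s <= m x s + D^-1.
have [x hx] : exists x, forall N, exists v u L' M,
    approx_profile N L' N.+1%:R^-1 v u M /\ good x M /\ \sum_s M s = 2^-1.
  apply: contrapT => /forallNP noX.
  have /choice[F hF] : forall x, exists N, ~ exists v u L' M,
      approx_profile N L' N.+1%:R^-1 v u M /\ good x M /\ \sum_s M s = 2^-1.
    by move=> x; have /existsNP := noX x.
  (* If each rounded vector failed from some index on, a block beyond all these indices would
     contradict the failure of its own rounding. *)
  pose N := (\max_x F x)%N.
  have [|v [u [L' [M [vuM M1]]]]] := @exists_approx_profile N N.+1%:R^-1.
    by rewrite invr_gt0.
  have M0 s : 0 <= M s by case: vuM => _ _ /profile_ge0.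
  have Mle s : M s <= 2^-1.
    by rewrite -M1 (bigD1 s)//= lerDl sumr_ge0.
  pose x : {ffun 'I_k.+1 -> 'I_(4 * k.+1).+1} := [ffun s => inord (Num.truncn (M s * D))].
  have MD s : 0 <= M s * D by rewrite mulr_ge0// ltW.
  have xE s : x s = Num.truncn (M s * D) :> nat.
    rewrite ffunE inordK// ltnS -(ler_nat R).
    apply: (@le_trans _ _ (M s * D)); first by rewrite truncn_le.
    rewrite natrM -/D ler_piMl ?(ltW D0)//; apply: le_trans (Mle s) _.
    by rewrite invf_le1// ler1n.
  apply: (hF x); exists v, u, L', M; split; last split => //.
    apply: approx_profileW vuM; first exact: leq_bigmax.
    by rewrite lef_pV2 ?posrE// ler_nat ltnS leq_bigmax.
  move=> s; rewrite /m xE; have /andP[h1 h2] := truncn_itv (MD s).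
  rewrite ler_pdivrMr// h1 /= -[X in _ + X]mul1r -mulrDl ler_pdivlMr//.
  by rewrite natr1 ltW.
(* The total rounding error, subtracted from the mass 1/2, leaves at least 1/4. *)
have DE : \sum_(s < k.+1) D^-1 = 4^-1.
  have K0 : k.+1%:R != 0 :> R by rewrite pnatr_eq0.
  by rewrite sumr_const card_ord -[LHS]mulr_natl /D; field.
exists (m x); split.
- by move=> s; rewrite divr_ge0// ltW.
- have [v [u [L' [M [_ [gx M1]]]]]] := hx 0%N.
  have : \sum_s M s <= \sum_s (m x s + D^-1) by apply: ler_sum => s _; have /andP[] := gx s.
  by rewrite big_split/= DE M1; lra.
- have [v [u [L' [M [_ [gx <-]]]]]] := hx 0%N.
  by apply: ler_sum => s _; have /andP[] := gx s.
move=> L e e0; pose N := maxn L (Num.truncn e^-1).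
have [v [u [L' [M [vuM [gx _]]]]]] := hx N; exists v, u, L', M; split => //.
apply: approx_profileW vuM; first exact: leq_maxl.
rewrite -[leRHS]invrK lef_pV2 ?posrE ?invr_gt0// ltW//.
apply: (lt_le_trans (truncnS_gt _)).
by rewrite ler_nat ltnS leq_maxr.
Qed.

(** Successive blocks are added, one per entry j of [J], with coefficient rho^(-j/p). Its p-th power
    is exactly a power of rho, so the classes shift by -j and the width stays 1. *)
Lemma exists_superblock_seq m d :
  (forall L e, 0 < e -> exists v u L' M, approx_profile L L' e v u M /\
    forall s, m s <= M s <= m s + d) ->
  forall (J : seq 'I_k.+1) L e, 0 < e -> exists v u L' M, approx_profile L L' e v u M /\
    forall s, \sum_(j <- J) rho `^ (- j%:R) * m (s + j) <= M s <=
      \sum_(j <- J) rho `^ (- j%:R) * (m (s + j) + d).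
Proof.
move=> H; elim=> [|j J IH] L e e0.
  exists (fun _ => 0), (fun _ => 0), L, (fun _ => 0); split.
    have z0 : (fun _ : nat => 0 - 0 : R) = (fun _ => 0) by apply/funext => c; rewrite subrr.
    rewrite /approx_profile z0; split => //; first by case: Xc.
    - exact: profile0.
    - exact: (@in_lp_fin_supp _ p _ 0).
    rewrite (@lpnorm_fin_supp _ p _ 0)// big_geq// powR0 ?ltW//.
    by rewrite gt_eqF// invr_gt0.
  by move=> s; rewrite !big_nil lexx.
have e20 : 0 < e / 2 by rewrite divr_gt0.
have [v [u [L1 [M [[vX LL1 uM vup vue] MJ]]]]] := IH L _ e20.
have [v' [u' [L2 [M' [[v'X LL2 u'M v'up v'ue] M'm]]]]] := H L1 _ e20.
pose a := rho `^ (- (j%:R / p)).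
have a0 : 0 < a by rewrite powR_gt0.
have ap : `|a| `^ p = rho `^ (- j%:R).
  by rewrite gtr0_norm// -powRrM mulNr divfK// gt_eqF.
have a1 : a <= 1.
  rewrite -[leRHS](powRr0 rho) ler_powR ?(ltW rho1)// oppr_le0 divr_ge0 ?(ltW p0)//.
have [vup' vue'] := lpnormZ a p0 v'up.
have [vup2 vue2] := lpnormD (ltW p1) vup vup'.
have := profileZ (d := 0) (t := - j%:Z) rho1 _ u'M.
move=> /(_ a); rewrite ap addr0 mulrNz lexx => /(_ isT).
rewrite residueN residue_ord addn0 => au'.
have uE : (fun c => (v c + a * v' c) - (u c + a * u' c)) =
    (fun c => (v c - u c) + a * (v' c - u' c)) by apply/funext => c; ring.
exists (fun c => v c + a * v' c), (fun c => u c + a * u' c), L2,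
  (fun s => M s + rho `^ (- j%:R) * M' (s + j)); split.
  rewrite /approx_profile uE; split => //.
  - by case: Xc => _ _ XD XZ _; apply: XD => //; exact: XZ.
  - exact: leq_trans LL2.
  - have := profileD p0 _ uM au'; rewrite LL1 LL2 => /(_ isT).
    by under [X in profile _ _ _ _ _ _ X -> _]eq_fun do rewrite opprK.
  apply: (le_trans vue2); rewrite vue' (gtr0_norm a0) (splitr e).
  apply: (lerD vue); apply: le_trans v'ue; apply: ler_piMl a1.
  exact: lpnorm_ge0.
move=> s; rewrite !big_cons ![rho `^ _ * _ + _]addrC.
have /andP[h1 h2] := MJ s; have /andP[h3 h4] := M'm (s + j).
by rewrite !lerD// ler_pM2l// powR_gt0.
Qed.

(** Every class receives the sum of [m] over all shifts, up to weights in [1/2, 1] and rounding: at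
    least half of 1/4, at most 1/2 + 1/4. *)
Lemma exists_superblock L e : 0 < e ->
  exists v u L' M, approx_profile L L' e v u M /\
  forall s, 8^-1 <= M s <= 1.
Proof.
move=> e0; have [m [m0 m1 m2 H]] := exists_common_masses.
(* As rho^j need not be an integer, its floor is the number of copies; it is at least rho^j / 2
   because rho^j >= 1. *)
pose n (j : 'I_k.+1) := Num.truncn (rho `^ j%:R).
pose J := flatten [seq nseq (n j) j | j <- enum 'I_k.+1].
have JE (F : 'I_k.+1 -> R) : \sum_(j <- J) F j = \sum_j (n j)%:R * F j.
  rewrite big_flatten/= big_map big_enum/=; apply: eq_bigr => j _.
  by rewrite big_nseq iter_addr_0 mulr_natl.
have nj (j : 'I_k.+1) : 2^-1 <= (n j)%:R * rho `^ (- j%:R) <= 1.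
  have h1 : 1 <= rho `^ j%:R by rewrite -[leLHS](powRr0 rho) ler_powR ?(ltW rho1).
  have r0 := lt_le_trans ltr01 h1.
  have /andP[t1 t2] := truncn_itv (ltW r0).
  rewrite powRN ler_pdivlMr// ler_pdivrMr// mul1r t1 andbT.
  have : (1 <= (n j)%:R :> R) by rewrite ler1n truncn_gt0.
  by move: t2; rewrite -natr1 -/(n j); lra.
have [v [u [L' [M [vuM hM]]]]] := exists_superblock_seq H J L e0.
exists v, u, L', M; split => // s; have /andP[h1 h2] := hM s.
have shift (F : 'I_k.+1 -> R) : \sum_j F (s + j) = \sum_j F j.
  by rewrite [RHS](reindex_inj (addrI s)).
have d0 : 0 <= (4 * k.+1%:R)^-1 :> R by rewrite invr_ge0 mulr_ge0.
apply/andP; split.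
  apply: le_trans h1; rewrite JE.
  apply: (@le_trans _ _ (\sum_j 2^-1 * m (s + j))).
    by rewrite -mulr_sumr shift; lra.
  by apply: ler_sum => j _; rewrite mulrA ler_wpM2r//; have /andP[] := nj j.
apply: le_trans h2 _; rewrite JE.
apply: (@le_trans _ _ (\sum_j (m (s + j) + (4 * k.+1%:R)^-1))).
  apply: ler_sum => j _; rewrite mulrA ler_piMl ?addr_ge0//.
  by have /andP[] := nj j.
rewrite (shift (fun j => m j + _)) big_split/= sumr_const card_ord -[_ *+ k.+1]mulr_natl.
have K0 : k.+1%:R != 0 :> R by rewrite pnatr_eq0.
have -> : k.+1%:R * (4 * k.+1%:R)^-1 = 4^-1 :> R by field.
by lra.
Qed.

End EquidistributedBlocks.

(** * Closed spans *)

Section Closure.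
Context {R : realType}.
Variable p : R.
Hypothesis p1 : 1 <= p.
Let p0 : 0 < p. Proof. exact: lt_le_trans p1. Qed.
Implicit Types (c e : R) (x y z : nat -> R) (S X : set (nat -> R)).

Lemma lpnormB x y : in_lp p x -> in_lp p y ->
  in_lp p (fun i => x i - y i) /\ lpnorm p (fun i => x i - y i) <= lpnorm p x + lpnorm p y.
Proof.
move=> xp yp; have [yp' ny] := lpnormZ (-1) p0 yp.
have [h1 h2] := lpnormD p1 xp yp'.
have E : (fun i => x i - y i) = (fun i => x i + -1 * y i).
  by apply/funext => i; rewrite mulN1r.
rewrite E; split; first exact: h1.
by rewrite ny normrN1 mul1r in h2; exact: h2.
Qed.

Lemma lpnorm_distC x y : in_lp p (fun i => x i - y i) ->
  in_lp p (fun i => y i - x i) /\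
  lpnorm p (fun i => y i - x i) = lpnorm p (fun i => x i - y i).
Proof.
move=> xyp; have [h1 h2] := lpnormZ (-1) p0 xyp.
have E : (fun i => y i - x i) = (fun i => -1 * (x i - y i)).
  by apply/funext => i; rewrite mulN1r opprB.
rewrite E; split; first exact: h1.
by rewrite h2 normrN1 mul1r.
Qed.

Definition lp_closure S : set (nat -> R) := [set x | in_lp p x /\
  forall e, 0 < e -> exists2 z, S z &
    in_lp p (fun i => x i - z i) /\ lpnorm p (fun i => x i - z i) <= e].

Lemma lp_zero : in_lp p (fun _ : nat => 0 : R) /\ lpnorm p (fun _ : nat => 0 : R) = 0.
Proof.
split; first exact: (@in_lp_fin_supp _ p _ 0).
rewrite (@lpnorm_fin_supp _ p _ 0)// big_geq// powR0//.
by rewrite gt_eqF// invr_gt0.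
Qed.

Lemma sub_lp_closure S : (forall z, S z -> in_lp p z) -> S `<=` lp_closure S.
Proof.
move=> Sp z Sz; split; first exact: Sp.
move=> e e0; exists z => //.
have -> : (fun i => z i - z i) = (fun _ => 0) by apply/funext => i; rewrite subrr.
by have [h ->] := lp_zero; split => //; exact: ltW.
Qed.

Lemma lp_closure_closed S :
  S (fun _ => 0) -> (forall x y, S x -> S y -> S (fun i => x i + y i)) ->
  (forall c x, S x -> S (fun i => c * x i)) ->
  closed_subspace_lp p (lp_closure S).
Proof.
move=> S0 SD SZ; split.
- by move=> x [].
- split; first by case: lp_zero.
  move=> e e0; exists (fun _ => 0) => //.
  have -> : (fun i : nat => 0 - 0 : R) = (fun _ => 0) by apply/funext => i; rewrite subrr.
  by have [h ->] := lp_zero; split => //; exact: ltW.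
- move=> x y [xp hx] [yp hy]; split; first by have [] := lpnormD p1 xp yp.
  move=> e e0; have e20 : 0 < e / 2 by rewrite divr_gt0.
  have [z Sz [zp ze]] := hx _ e20; have [t St [tp te]] := hy _ e20.
  exists (fun i => z i + t i); first exact: SD.
  have -> : (fun i => (x i + y i) - (z i + t i)) = (fun i => (x i - z i) + (y i - t i)).
    by apply/funext => i; ring.
  have [h1 h2] := lpnormD p1 zp tp; split; first exact: h1.
  by apply: (le_trans h2); rewrite (splitr e); exact: (lerD ze te).
- move=> c x [xp hx]; split; first by have [] := lpnormZ c p0 xp.
  (* Adding 1 covers c = 0. *)
  move=> e e0; have c0 : 0 < `|c| + 1 by rewrite ltr_wpDl.
  have [z Sz [zp ze]] := hx _ (divr_gt0 e0 c0).
  exists (fun i => c * z i); first exact: SZ.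
  have -> : (fun i => c * x i - c * z i) = (fun i => c * (x i - z i)).
    by apply/funext => i; ring.
  have [h1 h2] := lpnormZ c p0 zp; split; first exact: h1.
  rewrite h2; apply: (@le_trans _ _ ((`|c| + 1) * (e / (`|c| + 1)))).
    by apply: (ler_pM (normr_ge0 c) (lpnorm_ge0 _ _) _ ze); rewrite lerDl.
  by rewrite mulrC divfK// gt_eqF.
move=> u x hu xp ux; split => // e e0; have e20 : 0 < e / 2 by rewrite divr_gt0.
have /(cvgr_lt _ ux)[n _ hn] : 0 < e / 2 by [].
have {hn}un := hn n (leqnn n); have [up hz] := hu n.
have [z Sz [zp ze]] := hz _ e20; exists z => //.
have [h1 _] := lpnormB up xp; have [h2 h3] := lpnorm_distC h1.
have [h4 h5] := lpnormD p1 h2 zp.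
have E : (fun i => x i - z i) = (fun i => (x i - u n i) + (u n i - z i)).
  by apply/funext => i; ring.
rewrite E; split; first exact: h4.
by apply: (le_trans h5); rewrite (splitr e) h3; apply: lerD ze; exact: ltW.
Qed.

(** Approximants within 1/(n+1) form a sequence to which the closedness of X applies. *)
Lemma lp_closure_sub S X : closed_subspace_lp p X -> S `<=` X -> lp_closure S `<=` X.
Proof.
move=> [_ _ _ _ Xc] SX x [xp hx].
have /choice[z hz] : forall n : nat, exists z, [/\ S z, in_lp p (fun i => x i - z i) &
    lpnorm p (fun i => x i - z i) <= n.+1%:R^-1].
  by move=> n; have [|z Sz [h1 h2]] := hx n.+1%:R^-1; [rewrite invr_gt0|exists z].
apply: (Xc z x) => //; first by move=> n; have [/SX] := hz n.
apply: (squeeze_cvgr _ (cvg_cst 0) (@cvg_harmonic R)).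
apply: nearW => n; rewrite lpnorm_ge0/=.
by have [_ h1 h2] := hz n; have [_ ->] := lpnorm_distC h1.
Qed.

End Closure.

(** * Passing norm estimates to the closure *)

Section ClosureBounds.
Context {R : realType}.
Variables (p q : R) (r : nat).
Hypotheses (p1 : 1 <= p) (q0 : 0 < q) (pq : p^-1 + q^-1 = 1) (r0 : (0 < r)%N).
Let p0 : 0 < p. Proof. exact: lt_le_trans p1. Qed.
Implicit Types e : R.

(** Both norms are 1-Lipschitz for the l_p norm, the second one because it is dominated by the
    first. *)
Lemma lpnorm_tnorm_near (x z : nat -> R) e : in_lp p x -> in_lp p z ->
  in_lp p (fun i => x i - z i) -> lpnorm p (fun i => x i - z i) <= e ->
  [/\ lpnorm p x <= lpnorm p z + e & tnorm p q r x <= tnorm p q r z + e].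
Proof.
move=> xp zp xzp xze.
have E : x = (fun i => z i + (x i - z i)) by apply/funext => i; ring.
have [_ h] := lpnormD p1 zp xzp; rewrite -E in h.
have h' := tnormD p0 q0 pq r0 zp xzp; rewrite -E in h'.
split; first by apply: (le_trans h); rewrite lerD2l.
apply: (le_trans h'); rewrite lerD2l; apply: le_trans xze.
exact: tnorm_le_lpnorm.
Qed.

Lemma closure_bounds (S : set (nat -> R)) (a b c : R) : 0 <= a -> 0 <= b -> 0 <= c ->
  (forall z, S z -> in_lp p z) ->
  (forall z, S z -> a * lpnorm p z <= b * tnorm p q r z /\
     b * tnorm p q r z <= c * lpnorm p z) ->
  forall x, lp_closure p S x -> a * lpnorm p x <= b * tnorm p q r x /\
     b * tnorm p q r x <= c * lpnorm p x.
Proof.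
move=> a0 b0 c0 Sp Sb x [xp hx].
have near e : 0 < e -> a * lpnorm p x <= b * tnorm p q r x + (a + b) * e /\
    b * tnorm p q r x <= c * lpnorm p x + (b + c) * e.
  move=> e0; have [z Sz [xzp xze]] := hx e e0; have zp := Sp z Sz.
  have [h1 h2] := lpnorm_tnorm_near xp zp xzp xze.
  have [zxp zxE] := lpnorm_distC p1 xzp; rewrite -zxE in xze.
  have [h3 h4] := lpnorm_tnorm_near zp xp zxp xze.
  have [h5 h6] := Sb z Sz.
  have k1 := ler_wpM2l a0 h1; have k2 := ler_wpM2l b0 h4.
  have k3 := ler_wpM2l b0 h2; have k4 := ler_wpM2l c0 h3.
  move: k1 k2 k3 k4 h5 h6; clear.
  move: (lpnorm p x) (lpnorm p z) (tnorm p q r x) (tnorm p q r z) => A B C D.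
  by move=> *; split; lra.
have lim (s t d : R) : 0 <= d -> (forall e, 0 < e -> s <= t + d * e) -> s <= t.
  move=> d0 h; apply/ler_addgt0Pr => e e0.
  have d1 : 0 < d + 1 by rewrite ltr_wpDl.
  apply: le_trans (h _ (divr_gt0 e0 d1)) _; rewrite lerD2l mulrCA ler_piMr ?(ltW e0)//.
  by rewrite ler_pdivrMr// mul1r lerDl.
split.
  by apply: (lim _ _ (a + b)); [exact: addr_ge0|move=> e /near[]].
by apply: (lim _ _ (b + c)); [exact: addr_ge0|move=> e /near[]].
Qed.
End ClosureBounds.

(** * Combinations of superblocks *)

(** [A] and [C] are the l_p and Tsirelson norms of an element of the span, [B] and [D] those of its
    finitely supported approximant, and [K] is (k+1)^(1/p). The error 1/256 is half the lower bound
    1/128. *)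
Lemma perturbation_arith {R : realType} (A B C D K q : R) :
  A <= B + 256^-1 -> C <= D + 256^-1 -> B <= A + 256^-1 -> D <= C + 256^-1 ->
  B <= K -> K / 8 <= B -> D <= 3 * q + 16 -> 128^-1 <= D -> 1 <= K ->
  [/\ K / 16 <= A, A <= 2 * K, 256^-1 <= C & C <= 3 * q + 17].
Proof. by move=> *; split; lra. Qed.

Section Span.
Context {R : realType}.
Variables (p q rho : R) (r k : nat) (X : set (nat -> R)).
Hypotheses (p1 : 1 < p) (q1 : 1 < q) (pq : p^-1 + q^-1 = 1) (r1 : (1 < r)%N)
  (rho2 : 2 <= rho) (rho4 : rho <= 4) (rhok : rho `^ k.+1%:R = r%:R).
Hypotheses (Xc : closed_subspace_lp p X) (Xinf : inf_dim X).

Let p0 : 0 < p. Proof. exact: lt_trans p1. Qed.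
Let q0 : 0 < q. Proof. exact: lt_trans q1. Qed.
Let rho1 : 1 < rho. Proof. by apply: lt_le_trans rho2; rewrite ltr1n. Qed.
Let rho0 : 0 < rho. Proof. exact: lt_trans rho1. Qed.
Let r0 : (0 < r)%N. Proof. exact: ltnW. Qed.

(** Recursive choice: each window starts where the previous one ends, and the errors are halved so
    that they add up to at most 1/256. *)
Lemma exists_superblocks : exists (Z g : nat -> nat -> R) (L : nat -> nat)
    (M : nat -> 'I_k.+1 -> R), forall n,
  approx_profile p rho X (L n) (L n.+1) (256^-1 * 2^-1 ^+ n.+1) (Z n) (g n) (M n) /\
  forall s, 8^-1 <= M n s <= 1.
Proof.
have step (nL : nat * nat) : exists F : ((nat -> R) * (nat -> R)) * (nat * ('I_k.+1 -> R)),
    approx_profile p rho X nL.2 F.2.1 (256^-1 * 2^-1 ^+ nL.1.+1) F.1.1 F.1.2 F.2.2 /\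
    forall s, 8^-1 <= F.2.2 s <= 1.
  have e0 : 0 < 256^-1 * 2^-1 ^+ nL.1.+1 :> R by rewrite mulr_gt0// exprn_gt0.
  have [v [u [L' [M H]]]] := exists_superblock k p1 rho2 Xc Xinf nL.2 e0.
  by exists ((v, u), (L', M)).
have [F hF] := choice step.
pose L := fix L n := if n is m.+1 then (F (m, L m)).2.1 else 0%N.
exists (fun n => (F (n, L n)).1.1), (fun n => (F (n, L n)).1.2), L, (fun n => (F (n, L n)).2.2).
by move=> n; exact: (hF (n, L n)).
Qed.

Variables (Z g : nat -> nat -> R) (L : nat -> nat) (M : nat -> 'I_k.+1 -> R).
Hypothesis ZgM : forall n,
  approx_profile p rho X (L n) (L n.+1) (256^-1 * 2^-1 ^+ n.+1) (Z n) (g n) (M n) /\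
  forall s, 8^-1 <= M n s <= 1.

(** A scalar shifts the classes of its superblock and, being known up to a factor rho, raises the
    width from 1 to 2. Bounds valid for every class survive the shift. *)
Lemma superblock_comb (a : nat -> R) N : exists M' : 'I_k.+1 -> R,
  profile p rho (L 0) (L N) 2 (fun c => \sum_(n < N) a n * g n c) M' /\
  forall s, 8^-1 * \sum_(n < N) `|a n| `^ p <= M' s <= \sum_(n < N) `|a n| `^ p.
Proof.
have Lle n : (L 0 <= L n)%N.
  elim: n => // n; move/leq_trans; apply.
  by have [[_ + _ _ _] _] := ZgM n.
elim: N => [|N [M' [fM' hM']]].
  exists (fun _ => 0); split; last by move=> s; rewrite big_ord0 mulr0 lexx.
  rewrite (_ : (fun c => _) = (fun _ => 0)); first exact: profile0.
  by apply/funext => c; rewrite big_ord0.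
have [[_ LN gN _ _] MN] := ZgM N.
rewrite (_ : (fun c => _) = (fun c => \sum_(n < N) a n * g n c + a N * g N c)); last first.
  by apply/funext => c; rewrite big_ord_recr.
suff [M'' [aM'' hM'']] : exists M'' : 'I_k.+1 -> R,
    profile p rho (L N) (L N.+1) 2 (fun c => a N * g N c) M'' /\
    forall s, 8^-1 * `|a N| `^ p <= M'' s <= `|a N| `^ p.
  exists (fun s => M' s + M'' s); split.
    by apply: (profileD p0 _ fM' aM''); rewrite Lle.
  move=> s; have /andP[h1 h2] := hM' s; have /andP[h3 h4] := hM'' s.
  by rewrite big_ord_recr/= mulrDr !lerD.
(* A zero coefficient has no level and is treated apart. *)
have [aN0|aN0] := eqVneq (a N) 0.
  exists (fun _ => 0); rewrite aN0 normr0 powR0 ?gt_eqF// mulr0; split => [|s].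
    rewrite (_ : (fun c => _) = (fun _ => 0)); first exact: profile0.
    by apply/funext => c; rewrite mul0r.
  by rewrite lexx.
have aNp : 0 < `|a N| `^ p by rewrite powR_gt0// normr_gt0.
have [t ht] := exists_level rho1 aNp.
exists (fun s => `|a N| `^ p * M N (s - residue k t)); split.
  exact: (profileZ (d := 1) rho1 ht gN).
move=> s; have /andP[h1 h2] := MN (s - residue k t).
by rewrite mulrC ler_pM2l// h1 ler_piMr// ltW.
Qed.

Lemma comb_error (a : nat -> R) N : (forall n, (n < N)%N -> `|a n| <= 1) ->
  in_lp p (fun c => \sum_(n < N) a n * (Z n c - g n c)) /\
  lpnorm p (fun c => \sum_(n < N) a n * (Z n c - g n c)) <= 256^-1 * (1 - 2^-1 ^+ N).
Proof.
elim: N => [|N IH] a1.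
  rewrite (_ : (fun c => _) = (fun _ => 0)); last by apply/funext => c; rewrite big_ord0.
  by have [h ->] := lp_zero (ltW p1); split; [exact: h|rewrite expr0 subrr mulr0].
have [|h1 h2] := IH; first by move=> n nN; apply: a1; exact: ltnW.
have [[_ _ _ h3 h4] _] := ZgM N; have [h5 h6] := lpnormZ (a N) p0 h3.
have [h7 h8] := lpnormD (ltW p1) h1 h5.
rewrite (_ : (fun c => _) =
    (fun c => \sum_(n < N) a n * (Z n c - g n c) + a N * (Z N c - g N c))); last first.
  by apply/funext => c; rewrite big_ord_recr.
split; first exact: h7.
apply: (le_trans h8); rewrite h6.
have -> : 256^-1 * (1 - 2^-1 ^+ N.+1) =
    256^-1 * (1 - 2^-1 ^+ N) + 256^-1 * 2^-1 ^+ N.+1 :> R by rewrite exprS; field.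
apply: (lerD h2); apply: le_trans h4.
by apply: ler_piMl; [exact: lpnorm_ge0|exact: a1].
Qed.

Lemma in_lp_comb (a : nat -> R) N : in_lp p (fun c => \sum_(n < N) a n * Z n c).
Proof.
have ZX n : X (Z n) by have [[]] := ZgM n.
case: (Xc) => Xp _ _ _ _; apply: Xp.
have := subspace_sum Xc (index_enum 'I_N) (fun n : 'I_N => a n) (fun n => ZX n).
exact.
Qed.

(** The order of the l_p norm when each of the [k.+1] classes has mass of order 1. *)
Let K1 : R := k.+1%:R `^ p^-1.

Lemma K1_ge1 : 1 <= K1.
Proof. by rewrite /K1 -[leLHS](powRr0 k.+1%:R) ler_powR ?ler1n// invr_ge0 ltW. Qed.

Lemma pow2_le (x : R) : 1 < x -> rho `^ (2%:R / x) <= 16.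
Proof.
move=> x1; have x0 : 0 < x := lt_trans ltr01 x1.
apply: (@le_trans _ _ (rho `^ 2%:R)).
  rewrite ler_powR ?(ltW rho1)// ler_pdivrMr//.
  by rewrite ler_peMr// ltW.
rewrite powR_mulrn ?(ltW rho0)//.
by apply: (@le_trans _ _ (4 ^+ 2)); [rewrite lerXn2r ?nnegrE ?(ltW rho0)|rewrite -natrX].
Qed.

Section masses.
Variables (L0 L1 : nat) (f : nat -> R) (M' : 'I_k.+1 -> R).
Hypotheses (fM' : profile p rho L0 L1 2 f M') (hM' : forall s, 8^-1 <= M' s <= 1).

Let fL c : (L1 <= c)%N -> f c = 0. Proof. exact: profile_supp fM'. Qed.

Lemma profile_lpnorm_bounds : K1 / 8 <= lpnorm p f /\ lpnorm p f <= K1.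
Proof.
have V0 : 0 <= p^-1 by rewrite invr_ge0 ltW.
have V1 : p^-1 <= 1 by rewrite invf_le1// ltW.
rewrite (lpnorm_fin_supp p0 fL) (profile_sum fM'); split.
  apply: (@le_trans _ _ ((k.+1%:R / 8) `^ p^-1)).
    rewrite powRM ?invr_ge0// ler_wpM2l ?powR_ge0//.
    by rewrite -[leLHS]powRr1 ?invr_ge0// ger_powR// invr_gt0 ltr0n/= invf_le1// ler1n.
  apply: le_powR => //.
  apply: (@le_trans _ _ (\sum_(s < k.+1) 8^-1)).
    by rewrite sumr_const card_ord -[leRHS]mulr_natl.
  by apply: ler_sum => s _; have /andP[] := hM' s.
apply: le_powR => //.
  by rewrite sumr_ge0// => s _; exact: profile_ge0 fM'.
apply: (@le_trans _ _ (\sum_(s < k.+1) 1)); last by rewrite sumr_const card_ord.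
by apply: ler_sum => s _; have /andP[] := hM' s.
Qed.

(** Below, 128 = 16 * 8 combines rho^(2/q) <= 16 with the mass at least 1/8 of the class 0. Above,
    3q is the geometric sum and 16 bounds rho^(2/p). *)
Lemma profile_tnorm_bounds : 128^-1 <= tnorm p q r f /\ tnorm p q r f <= 3 * q + 16.
Proof.
split; last first.
  apply: tnorm_le => y yK.
  apply: le_trans (inner_profile_le p0 q0 pq rho1 r1 rhok fM' yK) _.
  rewrite lerD ?pow2_le//; apply: le_trans (sum_powR_geometric k.+1 rho2 q1).
  by apply: ler_sum => s _; rewrite ler_piMr ?powR_ge0//; have /andP[] := hM' s.
have /andP[h1 h2] := hM' 0.
have M0 : 0 < M' 0 by apply: lt_le_trans h1; rewrite invr_gt0.
have c128 : 128^-1 <= rho `^ (- (2%:R / q)) * M' 0.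
  have -> : 128^-1 = 16^-1 * 8^-1 :> R by field.
  apply: ler_pM; rewrite ?invr_ge0// powRN lef_pV2 ?posrE ?powR_gt0//.
  exact: pow2_le.
have [y yK hy] := inner_profile_ge p0 q0 pq rho1 r1 rhok fM' M0 h2.
apply: (le_trans c128); apply: (le_trans hy).
exact: (tnorm_ge p0 q0 pq r0 (in_lp_fin_supp p0 fL) yK).
Qed.
End masses.

Lemma normalized_comb_bounds (a : nat -> R) N : \sum_(n < N) `|a n| `^ p = 1 ->
  let z := fun c => \sum_(n < N) a n * Z n c in
  [/\ K1 / 16 <= lpnorm p z, lpnorm p z <= 2 * K1,
      256^-1 <= tnorm p q r z & tnorm p q r z <= 3 * q + 17].
Proof.
move=> a1 z; have [M' [fM' hM']] := superblock_comb a N.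
set f := (fun c => _) in fM'; rewrite a1 mulr1 in hM'.
have fL c : (L N <= c)%N -> f c = 0 by exact: profile_supp fM'.
have fp : in_lp p f := in_lp_fin_supp p0 fL.
have zp : in_lp p z := in_lp_comb a N.
have [ep en] : in_lp p (fun c => z c - f c) /\ lpnorm p (fun c => z c - f c) <= 256^-1.
  have [|h1 h2] := @comb_error a N.
    (* Each coefficient is at most 1 in absolute value because the p-th powers sum to 1. *)
    move=> n nN; rewrite leNgt; apply/negP => /(gt0_ltr_powR p0).
    rewrite !nnegrE ler01 normr_ge0 powR1 ltNge => /(_ isT isT)/negP; apply.
    rewrite -a1 (bigD1 (Ordinal nN))//= lerDl.
    by rewrite sumr_ge0// => ? _; rewrite powR_ge0.
  have -> : (fun c => z c - f c) = (fun c => \sum_(n < N) a n * (Z n c - g n c)).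
    by apply/funext => c; rewrite -sumrB; apply: eq_bigr => n _; rewrite mulrBr.
  split; first exact: h1.
  by apply: (le_trans h2); rewrite ler_piMr// gerBl exprn_ge0.
have [ze1 ze2] := lpnorm_tnorm_near (ltW p1) q0 pq r0 zp fp ep en.
have [ep' enE] := lpnorm_distC (ltW p1) ep; rewrite -enE in en.
have [fe1 fe2] := lpnorm_tnorm_near (ltW p1) q0 pq r0 fp zp ep' en.
have [fge fle] := profile_lpnorm_bounds fM' hM'.
have [tge tle] := profile_tnorm_bounds fM' hM'.
have K11 := K1_ge1.
exact: perturbation_arith ze1 ze2 fe1 fe2 fle fge tle tge K11.
Qed.

End Span.

(** [A] and [C] are the two norms of a normalized combination, [B] is (log_2 r)^(1/p) and [K] is
    (k+1)^(1/p). *)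
Lemma bounds_arith {R : realType} (p q B A C K : R) : 1 < p -> 1 < q ->
  K <= B -> B <= 2 * K -> 1 <= K -> K / 16 <= A -> A <= 2 * K ->
  256^-1 <= C -> C <= 3 * q + 17 ->
  4 ^- 6 * A <= B * C /\ B * C <= 3 * 4 ^+ 7 * (p + q) * A.
Proof.
move=> p1 q1 KB BK K1 KA AK C1 C2.
have -> : 4 ^- 6 = 4096^-1 :> R by rewrite -natrX.
have -> : 4 ^+ 7 = 16384 :> R by rewrite -natrX.
split; first by nra.
have h1 : B * C <= 2 * K * (3 * q + 17) by nra.
have h2 : (p + q) * (K / 16) <= (p + q) * A by nra.
nra.
Qed.

(** * Estimates and independence on the whole span *)

Section SpanBounds.
Context {R : realType}.
Variables (p q rho : R) (r k : nat) (X : set (nat -> R)).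
Hypotheses (p1 : 1 < p) (q1 : 1 < q) (pq : p^-1 + q^-1 = 1) (r1 : (1 < r)%N)
  (rho2 : 2 <= rho) (rho4 : rho <= 4) (rhok : rho `^ k.+1%:R = r%:R).
Hypotheses (Xc : closed_subspace_lp p X).
Variables (Z g : nat -> nat -> R) (L : nat -> nat) (M : nat -> 'I_k.+1 -> R).
Hypothesis ZgM : forall n,
  approx_profile p rho X (L n) (L n.+1) (256^-1 * 2^-1 ^+ n.+1) (Z n) (g n) (M n) /\
  forall s, 8^-1 <= M n s <= 1.

Let p0 : 0 < p. Proof. exact: lt_trans p1. Qed.
Let q0 : 0 < q. Proof. exact: lt_trans q1. Qed.
Let r0 : (0 < r)%N. Proof. exact: ltnW. Qed.

(** Homogeneity: [l] is the l_p norm of the coefficients, and if it vanishes so do they. *)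
Lemma comb_normalize (a : nat -> R) N :
  (forall n, (n < N)%N -> a n = 0) \/
  exists l (a' : nat -> R), [/\ 0 < l, \sum_(n < N) `|a' n| `^ p = 1 &
    (fun c => \sum_(n < N) a n * Z n c) = (fun c => l * \sum_(n < N) a' n * Z n c)].
Proof.
set A := \sum_(n < N) `|a n| `^ p.
have A0 : 0 <= A by rewrite sumr_ge0// => n _; rewrite powR_ge0.
have [Az|Az] := eqVneq A 0.
  left => n nN; apply/eqP; apply: contraT => an.
  have : 0 < A; last by rewrite Az ltxx.
  rewrite /A (bigD1 (Ordinal nN))//= ltr_pwDl ?powR_gt0 ?normr_gt0//.
  by rewrite sumr_ge0// => ? _; rewrite powR_ge0.
have {A0}Az : 0 < A by rewrite lt_neqAle eq_sym Az.
right; exists (A `^ p^-1), (fun n => a n / A `^ p^-1).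
have l0 : 0 < A `^ p^-1 by rewrite powR_gt0.
split => //.
  rewrite (eq_bigr (fun n : 'I_N => `|a n| `^ p / A)) => [|n _].
    by rewrite -mulr_suml mulfV// gt_eqF.
  rewrite normrM powRM// normfV (gtr0_norm l0) -powRN -powRrM mulNr mulVf ?gt_eqF//.
  by rewrite powR_inv1// ltW.
apply/funext => c; rewrite mulr_sumr; apply: eq_bigr => n _.
by rewrite mulrA mulrCA divff ?gt_eqF// mulr1.
Qed.

Variable B : R.
Hypotheses (KB : k.+1%:R `^ p^-1 <= B) (BK : B <= 2 * k.+1%:R `^ p^-1).

Lemma comb_bounds (a : nat -> R) N : let z := fun c => \sum_(n < N) a n * Z n c in
  4 ^- 6 * lpnorm p z <= B * tnorm p q r z /\
  B * tnorm p q r z <= 3 * 4 ^+ 7 * (p + q) * lpnorm p z.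
Proof.
rewrite /=; have [a0|[l [a' [l0 a'1 ->]]]] := comb_normalize a N.
  rewrite (_ : (fun c => _) = (fun _ => 0)); last first.
    by apply/funext => c; rewrite big1// => n _; rewrite a0 ?mul0r.
  have [zp z0] := @lp_zero R p (ltW p1).
  have -> : tnorm p q r (fun _ : nat => 0 : R) = 0.
    apply/eqP; rewrite eq_le; apply/andP; split.
      by have := tnorm_le_lpnorm p0 q0 pq r0 zp; rewrite z0.
    have K0 : KM q r (fun i => if i == 0%N then 1 else 0 : R) by apply: KM_unit; left.
    apply: le_trans (tnorm_ge p0 q0 pq r0 zp K0).
    rewrite (@inner_fin_supp _ _ _ 1%N); last by case.
    by rewrite big_nat1 mul0r.
  by rewrite z0 !mulr0.
have [h1 h2 h3 h4] :=
  normalized_comb_bounds p1 q1 pq r1 rho2 rho4 rhok Xc ZgM a'1.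
have [_ lz] := lpnormZ l p0 (in_lp_comb Xc ZgM a' N).
rewrite lz (gtr0_norm l0) (tnormZ p0 q0 pq r0 l0 (in_lp_comb Xc ZgM a' N)).
rewrite (mulrCA _ l) (mulrCA B l) (mulrCA _ l) !ler_pM2l//.
exact: (bounds_arith p1 q1 KB BK (K1_ge1 k p1) h1 h2 h3 h4).
Qed.

(** A normalized combination has norm at least (k+1)^(1/p) / 16, hence is not zero. *)
Lemma comb_indep (a : nat -> R) N :
  (forall c, \sum_(n < N) a n * Z n c = 0) -> forall n, (n < N)%N -> a n = 0.
Proof.
move=> az; have [//|[l [a' [l0 a'1 E]]]] := comb_normalize a N.
have [h1 _ _ _] := normalized_comb_bounds p1 q1 pq r1 rho2 rho4 rhok Xc ZgM a'1.
have z0 : (fun c => \sum_(n < N) a' n * Z n c) = (fun _ => 0).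
  apply/funext => c; have := congr1 (fun f => f c) E; rewrite az => /esym/eqP.
  by rewrite mulf_eq0 gt_eqF//= => /eqP.
exfalso; move: h1; rewrite z0 (lp_zero (ltW p1)).2 leNgt => /negP; apply.
by rewrite divr_gt0// (lt_le_trans ltr01 (K1_ge1 k p1)).
Qed.

End SpanBounds.

(** * Choice of the scale and conclusion *)

Theorem theorem4p1 (R : realType) (p q : R) (r : nat) :
  1 < p -> 1 < q -> p^-1 + q^-1 = 1 -> (1 < r)%N ->
  forall X : set (nat -> R), closed_subspace_lp p X -> inf_dim X ->
  exists Y : set (nat -> R),
    [/\ closed_subspace_lp p Y, Y `<=` X, inf_dim Y &
        forall x, Y x ->
          (4 ^- 6) * lpnorm p x <= (ln (r%:R) / ln 2) `^ (p^-1) * tnorm p q r x /\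
          (ln (r%:R) / ln 2) `^ (p^-1) * tnorm p q r x
            <= 3 * 4 ^+ 7 * (p + q) * lpnorm p x].
Proof.
move=> p1 q1 pq r1 X Xc Xinf.
have p0 : 0 < p := lt_trans ltr01 p1; have q0 : 0 < q := lt_trans ltr01 q1.
have r0 : (0 < r)%N by exact: ltnW.
have rR : 0 < r%:R :> R by rewrite ltr0n.
have K0 : (0 < trunc_log 2 r)%N by rewrite trunc_log_gt0.
have [k Kk] : exists k, trunc_log 2 r = k.+1 by exists (trunc_log 2 r).-1; rewrite prednK.
have kr : (2 ^ k.+1 <= r)%N by rewrite -Kk trunc_logP.
have rk : (r < 2 ^ k.+2)%N by rewrite -Kk trunc_log_ltn.
pose rho : R := r%:R `^ k.+1%:R^-1.
have KN0 : k.+1%:R != 0 :> R by rewrite pnatr_eq0.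
have KV0 : 0 <= k.+1%:R^-1 :> R by rewrite invr_ge0.
have rhok : rho `^ k.+1%:R = r%:R.
  by rewrite /rho -powRrM mulVf// powRr1// ltW.
have root (x : R) : 0 <= x -> (x ^+ k.+1) `^ k.+1%:R^-1 = x.
  by move=> x0; rewrite -powR_mulrn// -powRrM mulfV// powRr1.
have rho2 : 2 <= rho.
  rewrite -[leLHS]root//; apply: le_powR; rewrite ?exprn_ge0//.
  by rewrite -natrX ler_nat.
(* Uses r < 2^(k+2) and k + 2 <= 2(k+1). *)
have rho4 : rho <= 4.
  rewrite -[leRHS]root//; apply: le_powR => //.
  rewrite -natrX ler_nat; apply: leq_trans (ltnW rk) _.
  by rewrite -[4%N]/(2 ^ 2)%N -expnM leq_exp2l// mul2n -addnn addSn ltnS addnS ltnS leq_addr.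
have ln2 : 0 < ln 2 :> R by rewrite ln_gt0// ltr1n.
(* Hence log_2 r lies between k+1 and 2(k+1), and its power 1/p is comparable with (k+1)^(1/p) up to
   a factor 2. *)
have lnr1 : k.+1%:R * ln 2 <= ln (r%:R : R).
  by rewrite -ln_powR ler_ln ?posrE ?powR_gt0// powR_mulrn// -natrX ler_nat.
have lnr2 : ln (r%:R : R) <= 2 * k.+1%:R * ln 2.
  apply: (@le_trans _ _ (k.+2%:R * ln 2)).
    by rewrite -ln_powR ler_ln ?posrE ?powR_gt0// powR_mulrn// -natrX ler_nat ltnW.
  rewrite ler_pM2r// -natrM ler_nat mul2n -addnn.
  by rewrite addSn ltnS addnS ltnS leq_addr.
pose B := (ln (r%:R : R) / ln 2) `^ p^-1.
have pV0 : 0 <= p^-1 by rewrite invr_ge0 ltW.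
have KB : k.+1%:R `^ p^-1 <= B.
  by apply: le_powR => //; rewrite ler_pdivlMr.
have BK : B <= 2 * k.+1%:R `^ p^-1.
  apply: (@le_trans _ _ ((2 * k.+1%:R) `^ p^-1)).
    apply: le_powR => //; last by rewrite ler_pdivrMr.
    by rewrite divr_ge0 ?(ltW ln2)//; apply: le_trans lnr1; rewrite mulr_ge0// ltW.
  by rewrite powRM// ler_wpM2r ?powR_ge0// ler1_powR ?ler1n// invf_le1// ltW.
have [Z [g [L [M ZgM]]]] := exists_superblocks k p1 rho2 Xc Xinf.
pose S : set (nat -> R) := [set z | exists N (a : nat -> R),
  z = (fun c => \sum_(n < N) a n * Z n c)].
have ZX n : X (Z n) by have [[]] := ZgM n.
have SX : S `<=` X.
  move=> _ [N [a ->]].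
  exact: (subspace_sum Xc (index_enum 'I_N) (fun n : 'I_N => a n) (fun n => ZX n)).
have Sp z : S z -> in_lp p z by move=> [N [a ->]]; exact: (in_lp_comb Xc ZgM).
have S0 : S (fun _ => 0).
  by exists 0%N, (fun _ => 0); apply/funext => c; rewrite big_ord0.
have SZ c x : S x -> S (fun i => c * x i).
  move=> [N [a ->]]; exists N, (fun n => c * a n); apply/funext => i.
  by rewrite mulr_sumr; apply: eq_bigr => n _; rewrite mulrA.
(* Padding with zero coefficients brings two combinations to a common length. *)
have widen N N' (a : nat -> R) c : (N <= N')%N ->
    \sum_(n < N) a n * Z n c = \sum_(n < N') (if (n < N)%N then a n else 0) * Z n c.
  move=> NN'; rewrite (big_ord_widen _ (fun n => a n * Z n c) NN') big_mkcond/=.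
  by apply: eq_bigr => n _; case: ifP => // _; rewrite mul0r.
have SD x y : S x -> S y -> S (fun i => x i + y i).
  move=> [N [a ->]] [N' [b ->]]; exists (maxn N N'),
    (fun n => (if (n < N)%N then a n else 0) + (if (n < N')%N then b n else 0)).
  apply/funext => c; rewrite (widen _ _ _ _ (leq_maxl N N')) (widen _ _ _ _ (leq_maxr N N')).
  by rewrite -big_split; apply: eq_bigr => n _; rewrite mulrDl.
exists (lp_closure p S); split.
- exact: (lp_closure_closed (ltW p1) S0 SD SZ).
- exact: (lp_closure_sub (ltW p1) Xc SX).
- move=> n; exists (fun i : 'I_n => Z i); split.
    move=> i; apply: (sub_lp_closure (ltW p1) Sp).
    exists i.+1, (fun m : nat => (m == i :> nat)%:R); apply/funext => c.
    rewrite big_ord_recr/= eqxx mul1r big1 ?add0r// => m _.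
    by rewrite ltn_eqF// mul0r.
  move=> c h i.
  (* The coefficients on ['I_n] are extended by 0 to all indices. *)
  have := comb_indep p1 q1 pq r1 rho2 rho4 rhok Xc ZgM
    (a := fun m => oapp c 0 (insub m)) (N := n) _ (ltn_ord i).
  rewrite valK/=; apply => t; rewrite -[RHS](h t).
  by apply: eq_bigr => m _; rewrite valK.
have sb z : S z -> 4 ^- 6 * lpnorm p z <= B * tnorm p q r z /\
    B * tnorm p q r z <= 3 * 4 ^+ 7 * (p + q) * lpnorm p z.
  move=> [N [a ->]].
  exact: (comb_bounds p1 q1 pq r1 rho2 rho4 rhok Xc ZgM KB BK a N).
apply: (closure_bounds (ltW p1) q0 pq r0 _ _ _ Sp sb).
- by rewrite invr_ge0 exprn_ge0.
- exact: powR_ge0.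
- by rewrite !mulr_ge0 ?exprn_ge0// addr_ge0 ?ltW.
Qed.
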